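(* Let $(a_n)_{n\in\mathbb{N}}$ and $(b_n)_{n\in\mathbb{N}}$ be sequences in $\mathbb{R}$ with $a_n\in[0,1]$ and $b_n\in[0,n]$, and let $\Omega_n\subset\mathbb{R}^2$ be the (open) quadrilateral with vertices $(0,a_n)$, $(0,-1+a_n)$, $(b_n,0)$, $(-n+b_n,0)$. Then $$\frac{1}{|\Omega_n|}\|u_{\Omega_n}\|_1^2=O\big(n^{-2/3}\log n\big),\quad n\rightarrow\infty,$$ and the sequence $(u_{\Omega_n})$ is localising.
   Context: Here $\mathbb{N}=\{1,2,3,\dots\}$, and the open quadrilateral is the interior of the convex hull of the four listed points (which may degenerate to a triangle when $a_n\in\{0,1\}$ or $b_n\in\{0,n\}$). $|\cdot|$ is Lebesgue measure. For an open connected set $\Omega$ of finite measure, $u_\Omega\in H_0^1(\Omega)$ denotes the eigenfunction for the first eigenvalue of the Dirichlet Laplacian $-\Delta$ on $L^2(\Omega)$, chosen positive with $\|u_\Omega\|_2=1$; $\|\cdot\|_p$ is the $L^p$ norm on the set in question. Definition (localisation): a sequence $(f_n)$ with $f_n\in L^2(\Omega_n)$ and $\|f_n\|_2=1$ localises (is localising) if there exist measurable sets $A_n\subset\Omega_n$ such that $\lim_{n\to\infty}|A_n|/|\Omega_n|=0$ and $\lim_{n\to\infty}\int_{A_n}f_n^2=1$. *)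

(* Defs.v *)
From HB Require Import structures.
From mathcomp Require Import all_boot all_order all_algebra.
From mathcomp Require Import all_classical all_reals all_analysis.

Set Implicit Arguments.
Unset Strict Implicit.
Unset Printing Implicit Defensive.

Import Order.TTheory GRing.Theory Num.Theory.
Import numFieldNormedType.Exports.

Local Open Scope classical_set_scope.
Local Open Scope ring_scope.

(* The plane is [R * R]; [borel_plane R] is the same type with its Borel
   sigma-algebra, the domain of the product of two Lebesgue measures.  Every
   Lebesgue measurable set or function agrees with a Borel one up to a null
   set, so nothing is lost by using the uncompleted product measure. *)
Notation borel_plane R := (measurableTypeR R * measurableTypeR R)%type.

Definition leb2 (R : realType) : {measure set (borel_plane R) -> \bar R} :=
  (@lebesgue_measure R \x @lebesgue_measure R)%E.

Definition area (R : realType) (A : set (R * R)) : R := fine (leb2 R A).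

Definition normLp (R : realType) (W : set (R * R)) (p : R) (f : R * R -> R)
    : \bar R :=
  'N[leb2 R]_(p%:E)[EFin \o (f \_ W)]%E.

Definition in_L2 (R : realType) (W : set (R * R)) (f : R * R -> R) : Prop :=
  measurable_fun (T := borel_plane R) W f /\ (normLp W 2 f < +oo)%E.

Definition integral2 (R : realType) (W : set (R * R)) (f : R * R -> R) : R :=
  (\int[leb2 R]_(x in W) f x)%R.

Definition d1 (R : realType) (f : R * R -> R) : R * R -> R := 'D_(1, 0) f.
Definition d2 (R : realType) (f : R * R -> R) : R * R -> R := 'D_(0, 1) f.

Fixpoint Ck (R : realType) (k : nat) (f : R * R -> R) : Prop :=
  continuous f /\
  if k is k'.+1 then
    [/\ forall x, derivable f x (1, 0), forall x, derivable f x (0, 1),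
        Ck k' (d1 f) & Ck k' (d2 f)]
  else True.

(* The space C_c^oo(W). *)
Definition test_function (R : realType) (W : set (R * R)) (phi : R * R -> R)
    : Prop :=
  [/\ forall k, Ck k phi,
      compact (closure [set x | phi x != 0]) &
      closure [set x | phi x != 0] `<=` W].

(* u belongs to H^1(W), with weak gradient (g1, g2). *)
Definition H1 (R : realType) (W : set (R * R)) (u g1 g2 : R * R -> R) : Prop :=
  [/\ in_L2 W u, in_L2 W g1, in_L2 W g2 &
      forall phi, test_function W phi ->
        integral2 W (fun x => u x * d1 phi x)
          = - integral2 W (fun x => g1 x * phi x) /\
        integral2 W (fun x => u x * d2 phi x)
          = - integral2 W (fun x => g2 x * phi x)].

(* u belongs to H^1_0(W), the closure of C_c^oo(W) in H^1(W), and has weak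
   gradient (g1, g2). *)
Definition H10 (R : realType) (W : set (R * R)) (u g1 g2 : R * R -> R) : Prop :=
  H1 W u g1 g2 /\
  exists phi : nat -> R * R -> R,
    [/\ forall k, test_function W (phi k),
        (fun k => normLp W 2 (u \- phi k)) @ \oo --> 0%E,
        (fun k => normLp W 2 (g1 \- d1 (phi k))) @ \oo --> 0%E &
        (fun k => normLp W 2 (g2 \- d2 (phi k))) @ \oo --> 0%E].

(* u is in the domain of the Dirichlet Laplacian on L^2(W), that is of the
   self-adjoint operator associated with the form [\int_W Du . Dv] on
   H^1_0(W), and this operator maps u to f. *)
Definition dirichlet_laplacian (R : realType) (W : set (R * R))
    (u f : R * R -> R) : Prop :=
  in_L2 W f /\
  exists g1 g2, H10 W u g1 g2 /\
    forall v h1 h2, H10 W v h1 h2 ->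
      integral2 W (fun x => g1 x * h1 x + g2 x * h2 x)
        = integral2 W (fun x => f x * v x).

Definition dirichlet_eigenfunction (R : realType) (W : set (R * R))
    (lambda : R) (u : R * R -> R) : Prop :=
  ~ {ae leb2 R, forall x, W x -> u x = 0} /\
  dirichlet_laplacian W u (fun x => lambda * u x).

Definition first_eigenvalue (R : realType) (W : set (R * R)) (lambda : R)
    : Prop :=
  (exists u, dirichlet_eigenfunction W lambda u) /\
  forall mu v, dirichlet_eigenfunction W mu v -> lambda <= mu.

(* u is (a representative of the L^2 class of) u_W. *)
Definition first_eigenfunction (R : realType) (W : set (R * R))
    (u : R * R -> R) : Prop :=
  exists lambda,
    [/\ first_eigenvalue W lambda, dirichlet_eigenfunction W lambda u,
        {ae leb2 R, forall x, W x -> 0 < u x} &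
        normLp W 2 u = 1%E].

(* Sequences are indexed by the positive integers; their value at 0 is
   irrelevant. *)
Definition localising (R : realType) (W : nat -> set (R * R))
    (f : nat -> R * R -> R) : Prop :=
  (forall n, (0 < n)%N -> in_L2 (W n) (f n) /\ normLp (W n) 2 (f n) = 1%E) /\
  exists A : nat -> set (R * R),
    [/\ forall n, (0 < n)%N -> measurable (A n : set (borel_plane R)) /\ A n `<=` W n,
        (fun n => area (A n) / area (W n)) @ \oo --> (0 : R) &
        (fun n => integral2 (A n) (fun x => f n x ^+ 2)) @ \oo --> (1 : R)].

Definition convex_hull (R : realType) (A : set (R * R)) : set (R * R) :=
  smallest (@convex_set R (R * R)%type) A.

Definition open_quadrilateral (R : realType) (p q r s : R * R) : set (R * R) :=
  interior (convex_hull [set p; q; r; s]).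

(* Main.v *)
(* Write m = n^(1/3) and x for the abscissa.  The vertical slices of Omega_n
   have length at most 1 - |x|/n, so the one-dimensional Poincare inequality on
   slices gives lambda >= pi^2 \int (1 + 2|x|/n) u^2.  Conversely Omega_n
   contains a rectangle of length m and height 1 - 2m/n, whence
   lambda <= pi^2 + O(m^-2): this needs no min-max principle, because u > 0, so
   testing the equation against a smooth phi >= 0 with -Lap phi <= mu phi gives
   lambda <= mu.  Together, \int |x| u^2 <= 9m.  Hence u lives on |x| <= m^2, a
   set of area O(m^2) = o(n), and Cauchy-Schwarz with the weight 1 + |x|/m gives
   |u|_1^2 <= 10 \int_Omega (1 + |x|/m)^-1 = O(m log n). *)

Require Import Defs.
From HB Require Import structures.
From mathcomp Require Import all_boot all_order all_algebra.
From mathcomp Require Import all_classical all_reals all_analysis.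
From mathcomp Require Import measurable_realfun ring lra.
Import Order.TTheory GRing.Theory Num.Theory.
Import numFieldNormedType.Exports.
Local Open Scope classical_set_scope.
Local Open Scope ring_scope.

Set Implicit Arguments.
Unset Strict Implicit.

(** * Differentiation on the line *)

Section Deriv.
Context {R : realType}.
Implicit Types (f g : R -> R) (t a b : R).

(** The scale n^(1/3) is a balance: a rectangle of length L in the quadrilateral costs pi^2/L^2 in
    the long direction and, through its reduced height, a multiple of L/n in the short one; the two
    agree when L^3 is of order n. All bounds are uniform in a and b: a half of horizontal length c
    <= n has slices 1 - |x|/c <= 1 - |x|/n, and one of the two halves has c >= n/2. The delicate
    point is the smooth phi. The product of sines on the rectangle is neither compactly supported
    nor smooth when extended by zero, and a generic cutoff or mollifier may destroy the pointwise
    inequality -Lap phi <= mu phi. Each sine is therefore lowered by a small eta and composed with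
    the convex function E(s) = s exp(-eta/s), extended by 0 for s <= 0: the support moves strictly
    inside, smoothness holds to all orders, and convexity keeps the inequality at the price of a
    factor 1 + eps. With eps = m^-2 this loss has the order of the two others. Nothing is used on
    the regularity of u beyond membership in H^1_0: the Poincare inequality is proved for test
    functions and passed to the limit, and the upper bound moves all derivatives onto phi. *)

Lemma is_derive1_continuous f t a : is_derive t (1 : R) f a ->
  {for t, continuous f}.
Proof. by move=> [df _]; exact/differentiable_continuous/derivable1_diffP. Qed.

Lemma is_derive1_mul f g t a b : is_derive t (1 : R) f a ->
  is_derive t (1 : R) g b ->
  is_derive t (1 : R) (fun x => f x * g x) (a * g t + f t * b).
Proof.
move=> df dg; have := is_deriveM df dg.
by rewrite addrC /GRing.scale/= [g t * a]mulrC.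
Qed.

Lemma is_derive1_add f g t a b : is_derive t (1 : R) f a ->
  is_derive t (1 : R) g b ->
  is_derive t (1 : R) (fun x => f x + g x) (a + b).
Proof. by move=> df dg; have := is_deriveD df dg. Qed.

Lemma is_derive1_inv f t a : f t != 0 -> is_derive t (1 : R) f a ->
  is_derive t (1 : R) (fun x => (f x)^-1) (- (f t ^+ 2)^-1 * a).
Proof.
move=> f0 [df <-]; apply: DeriveDef; first exact: derivableV.
by rewrite deriveV// exprnN.
Qed.

Lemma is_derive1_affine (k c t : R) :
  is_derive t (1 : R) (fun x => k * (x - c)) k.
Proof.
have -> : (fun x => k * (x - c)) = (k \*: (id - cst c)) :> (R -> R).
  by apply/funext => x.
by apply: is_derive_eq; rewrite subr0 /GRing.scale/= mulr1.
Qed.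
End Deriv.

(** * Measurability in the plane *)

Section Plane.
Context {R : realType}.
Implicit Types (A W : set (R * R)) (f : R * R -> R).

(** The sigma-algebra of [borel_plane] comes from products of measurable sets, not from the topology
    of the plane. The link is that an open set is the countable union of the squares with rational
    centre and half-side that it contains. *)
Lemma open_plane_measurable A :
  open A -> measurable (A : set (borel_plane R)).
Proof.
move=> oA.
pose box (r a b : rat) : set (R * R) :=
  `]ratr a - ratr r, ratr a + ratr r[%classic `*`
  `]ratr b - ratr r, ratr b + ratr r[%classic.
pose S r a b := if pselect (box r a b `<=` A) then box r a b else set0.
have -> : A = \bigcup_r \bigcup_a \bigcup_b S r a b.
  apply/seteqP; split => [x Ax|x [r _ [a _ [b _]]]]; last first.
    by rewrite /S; case: pselect => // h; apply: h.
  have /nbhs_ballP[e /= e0 xeA] := open_nbhs_nbhs (conj oA Ax).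
  (* With half-side r < e/2 and centre within r of x in each coordinate, the square contains x and
     stays within 2r < e of it. *)
  have /rat_in_itvoo[r] : 0 < e / 2 by rewrite divr_gt0.
  rewrite in_itv/= => /andP[r0 re].
  have /rat_in_itvoo[a] : x.1 - ratr r < x.1 + ratr r by lra.
  rewrite in_itv/= => /andP[a1 a2].
  have /rat_in_itvoo[b] : x.2 - ratr r < x.2 + ratr r by lra.
  rewrite in_itv/= => /andP[b1 b2].
  exists r => //; exists a => //; exists b => //.
  rewrite /S; case: pselect => [h|h]; last first.
    exfalso; apply: h.
    move=> [y1 y2] [/=]; rewrite !in_itv/= => /andP[? ?] /andP[? ?].
    apply: xeA; split; rewrite /ball/= ltr_norml; apply/andP; split; lra.
  by split => /=; rewrite in_itv/=; apply/andP; split; lra.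
do 3!(apply: bigcupT_measurable_rat => ?); rewrite /S; case: pselect => [h|h] //.
  by apply: measurableX; exact: measurable_itv.
exact: measurable0.
Qed.

Lemma continuous_plane_measurable f W : measurable (W : set (borel_plane R)) ->
  continuous f -> measurable_fun (T := borel_plane R) W f.
Proof.
move=> mW /continuousP cf.
suff : measurable_fun (T := borel_plane R) setT f by exact: measurable_funTS.
apply: (measurability _ (measurable_realfun.RGenOpens.measurableE R)).
move=> _ [_ [a [b ->] <-]]; rewrite setTI; apply: open_plane_measurable.
exact/cf/interval_open.
Qed.
Lemma measurable_norm_fst (W : set (borel_plane R)) : measurable W ->
  measurable_fun W (fun z => `|z.1|).
Proof.
move=> mW; apply: continuous_plane_measurable => // z.
apply: (@continuous_comp _ _ _ fst (fun x : R => `|x|)); first exact: cvg_fst.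
exact: norm_continuous.
Qed.

Lemma measurable_norm_fst_le (c : R) :
  measurable ([set z | `|z.1| <= c] : set (borel_plane R)).
Proof.
have -> : [set z | `|z.1| <= c] =
    [set: borel_plane R] `&` (fun z => `|z.1|) @^-1` `]-oo, c]%classic.
  by rewrite setTI; apply/seteqP; split => z /=; rewrite in_itv.
by apply: measurable_norm_fst => //; exact: measurable_itv.
Qed.

End Plane.

(** * Test functions *)

Section Test.
Context {R : realType}.
Implicit Types (A W : set (R * R)) (f phi psi : R * R -> R).

Lemma derive_out_support f v x : ~ closure [set y | f y != 0] x ->
  'D_v f x = 0.
Proof.
move=> nx.
have -> : 'D_v f x = 'D_v (cst 0) x; last exact: derive_cst.
apply: near_eq_derive.
have : open_nbhs x (~` closure [set y | f y != 0]).
  by split => //; apply: closed_openC; exact: closed_closure.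
move=> /open_nbhs_nbhs; apply: filterS => y ny /=.
by apply/eqP/negP => fy; apply: ny; apply: subset_closure; apply/negP.
Qed.

Lemma test_function_eq0 W phi x : test_function W phi -> ~ W x -> phi x = 0.
Proof.
move=> [_ _ sW] nW; apply/eqP/negP => fx; apply/nW/sW/subset_closure.
exact/negP.
Qed.

Lemma test_function_d1 W phi : test_function W phi -> test_function W (d1 phi).
Proof.
move=> [ck cpt sW].
have sub : closure [set x | d1 phi x != 0] `<=` closure [set x | phi x != 0].
  rewrite [X in _ `<=` X](closure_id _).1; last exact: closed_closure.
  apply: closure_subset => x /= d0; apply: contrapT => /derive_out_support h.
  by move/eqP: d0; apply; exact: h.
split; last exact: subset_trans sub sW.
- by move=> k; have [_ []] := ck k.+1.
- by apply: (subclosed_compact _ cpt) => //; exact: closed_closure.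
Qed.

Lemma test_function_d2 W phi : test_function W phi -> test_function W (d2 phi).
Proof.
move=> [ck cpt sW].
have sub : closure [set x | d2 phi x != 0] `<=` closure [set x | phi x != 0].
  rewrite [X in _ `<=` X](closure_id _).1; last exact: closed_closure.
  apply: closure_subset => x /= d0; apply: contrapT => /derive_out_support h.
  by move/eqP: d0; apply; exact: h.
split; last exact: subset_trans sub sW.
- by move=> k; have [_ []] := ck k.+1.
- by apply: (subclosed_compact _ cpt) => //; exact: closed_closure.
Qed.

Lemma test_function_continuous W phi : test_function W phi -> continuous phi.
Proof. by case=> /(_ 0%N)[]. Qed.

Lemma test_function_derivable1 W phi x :
  test_function W phi -> derivable phi x (1, 0).
Proof. by case=> /(_ 1%N)[_ []]. Qed.

Lemma test_function_derivable2 W phi x :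
  test_function W phi -> derivable phi x (0, 1).
Proof. by case=> /(_ 1%N)[_ []]. Qed.

(** The inequalities are strict, so [f] also vanishes on the sides of the square; this kills the
    boundary terms when a primitive is evaluated at [- r] and [r]. *)
Definition box_supported (r : R) f :=
  forall x, ~~ [&& - r < x.1, x.1 < r, - r < x.2 & x.2 < r] -> f x = 0.

Lemma test_function_box W phi : test_function W phi ->
  exists2 r, 0 < r & box_supported r phi.
Proof.
move=> [_ /compact_bounded[M [Mr MB]] _]; pose r := 1 + Num.max M 0.
have Mr' : M < r by rewrite /r ltr_pwDl// le_max lexx.
have r0 : 0 < r by rewrite /r ltr_pwDl// le_max lexx orbT.
exists (r + 1); first by lra.
move=> [x1 x2] /= nx; apply/eqP/negP => fx; move/negP: nx; apply.
have : `|(x1, x2)| <= r by apply: MB => //; apply: subset_closure; exact/negP.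
rewrite prod_normE/= ge_max => /andP[]; rewrite !ler_norml.
by move=> /andP[? ?] /andP[? ?]; apply/and4P; split; lra.
Qed.

Lemma box_supported_bounded r f : continuous f -> box_supported r f ->
  exists2 M, 0 < M & forall x, `|f x| <= M.
Proof.
move=> cf bf.
have : compact (f @` (`[-r, r] `*` `[-r, r])).
  apply: continuous_compact; first exact: continuous_subspaceT.
  by apply: compact_setX; exact: segment_compact.
move=> /compact_bounded[M [Mr MB]]; exists (1 + Num.max M 0).
  by rewrite ltr_pwDl// le_max lexx orbT.
move=> x; have [h|h] := boolP [&& - r < x.1, x.1 < r, - r < x.2 & x.2 < r].
- apply: MB; first by rewrite ltr_pwDl// le_max lexx.
  exists x => //; move/and4P : h => [a b c d].
  by split; rewrite /= in_itv/=; apply/andP; split; exact: ltW.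
- by rewrite bf// normr0 addr_ge0// le_max lexx orbT.
Qed.

Lemma leb2_rect (a b c d : R) : a <= b -> c <= d ->
  leb2 R (`[a, b] `*` `[c, d]) = ((b - a) * (d - c))%:E.
Proof.
move=> ab cd; rewrite [LHS]product_measure1E; try exact: measurable_itv.
rewrite /= !lebesgue_measure_itv/= !lte_fin.
move: ab cd; rewrite !le_eqVlt => /predU1P[->|ab] /predU1P[->|cd];
  by rewrite ?ltxx ?ab ?cd ?subrr ?mul0r ?mulr0 ?mul0e ?mule0.
Qed.

Lemma box_supported_integrable r f : continuous f -> box_supported r f ->
  (leb2 R).-integrable setT (EFin \o f).
Proof.
move=> cf bf; pose B : set (R * R) := `[-r, r] `*` `[-r, r].
have mB : measurable (B : set (borel_plane R)).
  by apply: measurableX; exact: measurable_itv.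
have -> : EFin \o f = (EFin \o f) \_ B.
  apply/funext => x; rewrite patchE; case: ifPn => // /negP xB /=.
  rewrite bf//; apply/negP => /and4P[a b c d]; apply: xB; rewrite inE.
  by split; rewrite /= in_itv/=; apply/andP; split; exact: ltW.
apply/(integrable_mkcond _ mB).
have [r0|r0] := leP (-r) r; last first.
  have -> : B = set0; last exact: integrable_set0.
  by rewrite /B set_itv_ge ?bnd_simp -?ltNge// set0X.
apply: measurable_bounded_integrable => //.
- by rewrite leb2_rect// ltry.
- exact: continuous_plane_measurable.
- have [M M0 fM] := box_supported_bounded cf bf.
  exists M; split; first exact: num_real.
  by move=> y My x _; exact: le_trans (fM x) (ltW My).
Qed.

Lemma derivable1_section f x y : derivable f (x, y) (1, 0) ->
  derivable (fun t => f (t, y)) x 1 /\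
  (fun t => f (t, y))^`()%classic x = d1 f (x, y).
Proof.
rewrite derive1E /d1 /derivable /derive.
have -> : (fun h : R => h^-1 *: ((f \o shift (x, y)) (h *: (1, 0)) - f (x, y)))
  = (fun h : R => h^-1 *: (((fun t => f (t, y)) \o shift x) (h *: 1) -
    f (x, y))); last by [].
apply/funext => h /=; congr (_ *: (f _ - _)).
by congr pair; rewrite /= scaler0 add0r.
Qed.

Lemma derivable2_section f x y : derivable f (x, y) (0, 1) ->
  derivable (fun t => f (x, t)) y 1 /\
  (fun t => f (x, t))^`()%classic y = d2 f (x, y).
Proof.
rewrite derive1E /d2 /derivable /derive.
have -> : (fun h : R => h^-1 *: ((f \o shift (x, y)) (h *: (0, 1)) - f (x, y)))
  = (fun h : R => h^-1 *: (((fun t => f (x, t)) \o shift y) (h *: 1) -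
    f (x, y))); last by [].
apply/funext => h /=; congr (_ *: (f _ - _)).
by congr pair; rewrite /= scaler0 add0r.
Qed.
End Test.

(** * Integration by parts for test functions *)

Section IBP.
Context {R : realType}.
Implicit Types (A W : set (R * R)) (f phi psi : R * R -> R).
Notation mu := (@lebesgue_measure R).

Lemma continuous_pairl (y : R) : continuous (fun t:R => (t,y)).
Proof.
move=> t; apply: (@filter.cvg_pair _ _ _ (nbhs t) (nbhs t) (nbhs y)) => //.
exact: cvg_cst.
Qed.
Lemma continuous_pairr (y : R) : continuous (fun t:R => (y,t)).
Proof.
move=> t; apply: (@filter.cvg_pair _ _ _ (nbhs t) (nbhs y) (nbhs t)) => //.
exact: cvg_cst.
Qed.

Lemma integral_supportE (a b : R) (g : R -> R) :
  (forall t, ~~ (a <= t <= b) -> g t = 0) ->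
  (\int[mu]_t (g t)%:E = \int[mu]_(t in `[a, b]) (g t)%:E)%E.
Proof.
move=> g0; rewrite [RHS]integral_mkcond; apply: eq_integral => t _.
rewrite patchE; case: ifPn => // /negP tn; rewrite g0//.
by apply/negP => h; apply: tn; rewrite inE/= in_itv.
Qed.

Lemma integral_derive1_eq0 (a b : R) (G g : R -> R) : a < b ->
  {in `[a, b], continuous g} -> {in `[a, b], forall t : R, is_derive t (1 : R) G (g t)} ->
  G a = 0 -> G b = 0 ->
  (\int[mu]_(t in `[a, b]) (g t)%:E = 0)%E.
Proof.
move=> ab cg dG Ga Gb.
rewrite (@continuous_FTC2 _ g G)//; first by rewrite Ga Gb subee.
- by apply: continuous_in_subspaceT => x; rewrite inE; exact: cg.
- have cG x : x \in `[a, b] -> {for x, continuous G}.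
    by move=> /dG h; exact/differentiable_continuous/derivable1_diffP.
  split.
  + move=> x xab; have xab' : x \in `[a, b] by exact: subset_itv_oo_cc.
    by have := dG _ xab'.
  + apply: cvg_at_right_filter; apply: cG.
    by rewrite in_itv/= lexx ltW.
  + apply: cvg_at_left_filter; apply: cG.
    by rewrite in_itv/= lexx ltW.
- move=> x xab; have xab' : x \in `[a, b] by exact: subset_itv_oo_cc.
  by rewrite derive1E; have [_] := dG _ xab'.
Qed.

(** Fubini with the first variable innermost: on each horizontal line the integral is a difference
    of two boundary values, both zero by [box_supported]. *)
Lemma integral_d1_eq0 r f : 0 < r -> continuous (d1 f) ->
  (forall x, derivable f x (1, 0)) ->
  box_supported r f -> box_supported r (d1 f) ->
  (\int[leb2 R]_x (d1 f x)%:E = 0)%E.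
Proof.
move=> r0 cd df bf bd.
rewrite -(integral21_prod_meas1 (box_supported_integrable cd bd)).
apply: integral0_eq => y _; rewrite /fubini_G/=.
rewrite (@integral_supportE (- r) r); last first.
  move=> t tn; apply: bd => /=; apply: contra tn => /and4P[? ? _ _].
  by rewrite !ltW.
apply: (@integral_derive1_eq0 _ _ (fun t => f (t, y))).
- by rewrite gtrN.
- move=> t _; apply: (@continuous_comp _ _ _ (fun t => (t, y)) (d1 f)) => //.
    exact: continuous_pairl.
  exact: cd.
- move=> t _; have [dt e] := derivable1_section (df (t, y)).
  by apply: (DeriveDef dt); rewrite -derive1E.
- by apply: bf; rewrite /= ltxx.
- by apply: bf; rewrite /= ltxx andbF.
Qed.

Lemma integral_d2_eq0 r f : 0 < r -> continuous (d2 f) ->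
  (forall x, derivable f x (0, 1)) ->
  box_supported r f -> box_supported r (d2 f) ->
  (\int[leb2 R]_x (d2 f x)%:E = 0)%E.
Proof.
move=> r0 cd df bf bd.
rewrite -(integral12_prod_meas1 (box_supported_integrable cd bd)).
apply: integral0_eq => y _; rewrite /fubini_F/=.
rewrite (@integral_supportE (- r) r); last first.
  move=> t tn; apply: bd => /=; apply: contra tn => /and4P[_ _ ? ?].
  by rewrite !ltW.
apply: (@integral_derive1_eq0 _ _ (fun t => f (y, t))).
- by rewrite gtrN.
- move=> t _; apply: (@continuous_comp _ _ _ (fun t => (y, t)) (d2 f)) => //.
    exact: continuous_pairr.
  exact: cd.
- move=> t _; have [dt e] := derivable2_section (df (y, t)).
  by apply: (DeriveDef dt); rewrite -derive1E.
- by apply: bf; rewrite /= ltxx !andbF.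
- by apply: bf; rewrite /= ltxx !andbF.
Qed.

Lemma integral2_mkcond W f : (forall x, ~ W x -> f x = 0) ->
  integral2 W f = integral2 setT f.
Proof.
move=> f0; rewrite /integral2 Rintegral_mkcond; apply: eq_Rintegral => x _.
by rewrite patchE; case: ifPn => // /negP; rewrite inE => /f0.
Qed.

(** By the product rule the two integrands add up to [d1 (phi * psi)], whose integral over the plane
    is zero. *)
Lemma test_function_ibp1 W phi psi :
  test_function W phi -> test_function W psi ->
  integral2 W (fun x => phi x * d1 psi x)
    = - integral2 W (fun x => d1 phi x * psi x).
Proof.
move=> tp tq.
have p0 := test_function_eq0 tp; have q0 := test_function_eq0 tq.
rewrite !integral2_mkcond; [|by move=> x /q0 ->; rewrite mulr0
  |by move=> x /p0 ->; rewrite mul0r].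
have [r r0 br] := test_function_box tp.
have cp := test_function_continuous tp; have cq := test_function_continuous tq.
have cdp := test_function_continuous (test_function_d1 tp).
have cdq := test_function_continuous (test_function_d1 tq).
have dp x : derivable phi x (1, 0) by exact: test_function_derivable1 tp.
have dq x : derivable psi x (1, 0) by exact: test_function_derivable1 tq.
have [r' r'0 brd] := test_function_box (test_function_d1 tp).
(* The squares for [phi] and [d1 phi] come from separate existence statements; the larger one serves
   both. *)
pose s := Num.max r r'.
have bS (g : R * R -> R) t : t <= s -> box_supported t g -> box_supported s g.
  move=> ts bg x xn; apply: bg; apply: contra xn => /and4P[? ? ? ?].
  by apply/and4P; split; lra.
have rs : r <= s by rewrite le_max lexx.
have r's : r' <= s by rewrite le_max lexx orbT.
have dpq x : d1 (phi * psi) x = phi x * d1 psi x + d1 phi x * psi x.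
  by rewrite /d1 deriveM// addrC [X in X + _ = _]mulrC [in RHS]addrC.
have c1 : continuous (fun x => phi x * d1 psi x).
  by move=> x; apply: cvgM; [exact: cp|exact: cdq].
have c2 : continuous (fun x => d1 phi x * psi x).
  by move=> x; apply: cvgM; [exact: cdp|exact: cq].
have b1 : box_supported s (fun x => phi x * d1 psi x).
  by move=> x /(bS _ _ rs br) ->; rewrite mul0r.
have b2 : box_supported s (fun x => d1 phi x * psi x).
  by move=> x /(bS _ _ r's brd) ->; rewrite mul0r.
have i1 := box_supported_integrable c1 b1.
have i2 := box_supported_integrable c2 b2.
apply/eqP; rewrite -addr_eq0 /integral2 -RintegralD//; apply/eqP.
rewrite /Rintegral.
under eq_integral do rewrite -dpq.
suff -> : (\int[leb2 R]_x (d1 (phi * psi) x)%:E = 0)%E by [].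
apply: (@integral_d1_eq0 s).
- by rewrite (lt_le_trans r0).
- rewrite (_ : d1 _ = (fun x => phi x * d1 psi x) \+ (fun x => d1 phi x * psi x)).
    by move=> x; apply: cvgD; [exact: c1|exact: c2].
  by apply/funext => x; rewrite dpq.
- by move=> x; apply: derivableM.
- by move=> x xs; rewrite /= !fctE (bS _ _ rs br x xs) mul0r.
- by move=> x xs; rewrite dpq b1// b2// addr0.
Qed.

Lemma test_function_ibp2 W phi psi :
  test_function W phi -> test_function W psi ->
  integral2 W (fun x => phi x * d2 psi x)
    = - integral2 W (fun x => d2 phi x * psi x).
Proof.
move=> tp tq.
have p0 := test_function_eq0 tp; have q0 := test_function_eq0 tq.
rewrite !integral2_mkcond; [|by move=> x /q0 ->; rewrite mulr0
  |by move=> x /p0 ->; rewrite mul0r].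
have [r r0 br] := test_function_box tp.
have cp := test_function_continuous tp; have cq := test_function_continuous tq.
have cdp := test_function_continuous (test_function_d2 tp).
have cdq := test_function_continuous (test_function_d2 tq).
have dp x : derivable phi x (0, 1) by exact: test_function_derivable2 tp.
have dq x : derivable psi x (0, 1) by exact: test_function_derivable2 tq.
have [r' r'0 brd] := test_function_box (test_function_d2 tp).
pose s := Num.max r r'.
have bS (g : R * R -> R) t : t <= s -> box_supported t g -> box_supported s g.
  move=> ts bg x xn; apply: bg; apply: contra xn => /and4P[? ? ? ?].
  by apply/and4P; split; lra.
have rs : r <= s by rewrite le_max lexx.
have r's : r' <= s by rewrite le_max lexx orbT.
have dpq x : d2 (phi * psi) x = phi x * d2 psi x + d2 phi x * psi x.
  by rewrite /d2 deriveM// addrC [X in X + _ = _]mulrC [in RHS]addrC.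
have c1 : continuous (fun x => phi x * d2 psi x).
  by move=> x; apply: cvgM; [exact: cp|exact: cdq].
have c2 : continuous (fun x => d2 phi x * psi x).
  by move=> x; apply: cvgM; [exact: cdp|exact: cq].
have b1 : box_supported s (fun x => phi x * d2 psi x).
  by move=> x /(bS _ _ rs br) ->; rewrite mul0r.
have b2 : box_supported s (fun x => d2 phi x * psi x).
  by move=> x /(bS _ _ r's brd) ->; rewrite mul0r.
have i1 := box_supported_integrable c1 b1.
have i2 := box_supported_integrable c2 b2.
apply/eqP; rewrite -addr_eq0 /integral2 -RintegralD//; apply/eqP.
rewrite /Rintegral.
under eq_integral do rewrite -dpq.
suff -> : (\int[leb2 R]_x (d2 (phi * psi) x)%:E = 0)%E by [].
apply: (@integral_d2_eq0 s).
- by rewrite (lt_le_trans r0).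
- rewrite (_ : d2 _ = (fun x => phi x * d2 psi x) \+ (fun x => d2 phi x * psi x)).
    by move=> x; apply: cvgD; [exact: c1|exact: c2].
  by apply/funext => x; rewrite dpq.
- by move=> x; apply: derivableM.
- by move=> x xs; rewrite /= !fctE (bS _ _ rs br x xs) mul0r.
- by move=> x xs; rewrite dpq b1// b2// addr0.
Qed.
End IBP.

(** * The one-dimensional Poincare inequality *)

Section Poincare.
Context {R : realType}.
Notation mu := (@lebesgue_measure R).

Lemma gt_nbhsr (t a : R) : a < t -> \forall x \near t, a < x.
Proof. by move=> h; apply: open_nbhs_nbhs; split => //; exact: open_gt. Qed.

(* With q = k cot (k (t - c)), integrate (g - q f)^2 >= 0 and use that
   (q f^2)' = 2 q f g - (k^2 + q^2) f^2 has integral zero. *)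
Lemma poincare_strict (al l k : R) (f g : R -> R) :
  0 <= l -> 0 < k -> k * l < pi ->
  continuous g -> (forall t : R, is_derive t (1 : R) f (g t)) ->
  (forall t, ~~ (al <= t <= al + l) -> f t = 0) ->
  (\int[mu]_t (k ^+ 2 * f t ^+ 2)%:E <= \int[mu]_t (g t ^+ 2)%:E)%E.
Proof.
move=> l0 k0 klpi cg df f0.
(* The slack in [k * l < pi] is cut into four parts: the sine has its zeros at distance [2 * de]
   from the support interval, and the integration runs over [[a, b]], which exceeds that interval by
   only [de] on each side. So [s] stays positive on [[a, b]], while [f] vanishes at both ends. *)
pose de := (pi / k - l) / 4.
have de0 : 0 < de by rewrite divr_gt0// subr_gt0 ltr_pdivlMr// mulrC.
have kde : k * (l + 4 * de) = pi by rewrite /de; field; rewrite gt_eqF.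
pose a := al - de; pose b := al + l + de; pose c := al - 2 * de.
have ab : a < b by rewrite /a /b; lra.
have cf : continuous f.
  by move=> t; apply/differentiable_continuous/derivable1_diffP; have [] := df t.
pose s t := sin (k * (t - c)); pose q t := cos (k * (t - c)).
have s0 t : t \in `[a, b] -> 0 < s t.
  rewrite in_itv/= /a /b => /andP[ta tb]; apply: sin_gt0_pi; apply/andP; split.
    by rewrite mulr_gt0// /c; lra.
  by rewrite -kde ltr_pM2l// /c; lra.
have fa : f a = 0 by apply: f0; rewrite negb_and -!ltNge /a; apply/orP; left; lra.
have fb : f b = 0 by apply: f0; rewrite negb_and -!ltNge /b; apply/orP; right; lra.
(* Here [q] is only the cosine; the cotangent factor k cot (k (t - c)) is [k * q t / s t]. *)
pose F t := k * f t ^+ 2 * q t * (s t)^-1.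
pose F' t := 2 * k * f t * g t * q t * (s t)^-1 - k ^+ 2 * f t ^+ 2 * (s t ^+ 2)^-1.
have dlin t : is_derive t (1:R) (fun t => k * (t - c)) k.
  exact: is_derive1_affine.
have ds t : is_derive t (1:R) s (q t * k).
  by apply: is_derive1_comp; exact: dlin.
have dq t : is_derive t (1:R) q (- s t * k).
  by apply: is_derive1_comp; exact: dlin.
have cs t : {for t, continuous s} by exact: is_derive1_continuous (ds t).
have cq t : {for t, continuous q} by exact: is_derive1_continuous (dq t).
have dF : {in `[a, b], forall t : R, is_derive t (1:R) F (F' t)}.
  move=> t /s0 st.
  have df2 := is_derive1_mul (df t) (df t).
  have dV := is_derive1_inv (lt0r_neq0 st) (ds t).
  have dd := is_derive1_mul (is_derive1_mul (is_derive1_mul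
    (is_derive_cst k t (1:R)) df2) (dq t)) dV.
  apply: (is_derive_eq dd).
  rewrite /F' /cst.
  have cs1 : q t ^+ 2 = 1 - s t ^+ 2.
    by have := cos2Dsin2 (k * (t - c)); rewrite -/(q t) -/(s t) => <-; ring.
  transitivity (2 * k * f t * g t * q t / s t - k ^+ 2 * f t ^+ 2 * (s t ^+ 2 + q t ^+ 2) / s t ^+ 2).
    by field; rewrite gt_eqF.
  by rewrite cs1; field; rewrite gt_eqF.
have cF' : {in `[a, b], continuous F'}.
  move=> t /s0 st.
  apply: cvgB; apply: cvgM.
  - apply: cvgM; last exact: cq.
    apply: cvgM; last exact: cg.
    by apply: cvgM; [exact: cvg_cst|exact: cf].
  - by apply: cvgV; [rewrite gt_eqF|exact: cs].
  - by apply: cvgM; [exact: cvg_cst|apply: (cvgM (cf t) (cf t))].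
  - by apply: cvgV; [rewrite sqrf_eq0 gt_eqF|apply: (cvgM (cs t) (cs t))].
have iF' : (\int[mu]_(t in `[a, b]) (F' t)%:E = 0)%E.
  by apply: (integral_derive1_eq0 ab cF' dF);
    rewrite /F ?fa ?fb expr0n/= mulr0 !mul0r.
have cS (h : R -> R) : {in `[a, b], continuous h} ->
    mu.-integrable `[a, b] (EFin \o h).
  move=> ch; apply: continuous_compact_integrable; first exact: segment_compact.
  by apply: continuous_in_subspaceT => x; rewrite inE; exact: ch.
have g0 t : ~~ (al <= t <= al + l) -> g t = 0.
  move=> tn; have [_ <-] := df t.
  have -> : 'D_1 f t = 'D_1 (cst 0) t; last exact: derive_cst.
  apply: near_eq_derive.
  move: tn; rewrite negb_and -!ltNge => /orP[h|h].
    apply: filterS (lt_nbhsl h) => x xh; apply: f0.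
    by rewrite negb_and -!ltNge xh.
  apply: filterS (gt_nbhsr h) => x xh; apply: f0.
  by rewrite negb_and -!ltNge xh orbT.
have abl t : ~~ (a <= t <= b) -> ~~ (al <= t <= al + l).
  apply: contra => /andP[? ?]; rewrite /a /b; apply/andP; split; lra.
rewrite (@integral_supportE _ a b); last first.
  by move=> t /abl/f0 ->; rewrite expr0n/= mulr0.
rewrite (@integral_supportE _ a b); last by move=> t /abl/g0 ->; rewrite expr0n.
have if2 : mu.-integrable `[a, b] (EFin \o (fun t => k ^+ 2 * f t ^+ 2)).
  by apply: cS => t _; apply: cvgM; [exact: cvg_cst|apply: (cvgM (cf t) (cf t))].
have ig2 : mu.-integrable `[a, b] (EFin \o (fun t => g t ^+ 2)).
  by apply: cS => t _; apply: (cvgM (cg t) (cg t)).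
have e := @integralD_EFin _ _ _ mu _ (measurable_itv `[a, b]) _ _ if2 (cS _ cF').
rewrite [X in _ = (_ + X)%E]iF' adde0 in e; rewrite -[leLHS]e.
apply: le_integral => //.
  apply: cS => t tab; apply: cvgD; last exact: cF'.
  by apply: cvgM; [exact: cvg_cst|apply: (cvgM (cf t) (cf t))].
move=> t; rewrite inE => /s0 st; rewrite lee_fin -subr_ge0.
rewrite (_ : _ - _ = (g t - k * f t * q t / s t) ^+ 2) ?sqr_ge0//.
have cs1 : q t ^+ 2 = 1 - s t ^+ 2.
  by have := cos2Dsin2 (k * (t - c)); rewrite -/(q t) -/(s t) => <-; ring.
transitivity (g t ^+ 2 - 2 * k * f t * g t * q t / s t
  + k ^+ 2 * f t ^+ 2 * (1 - s t ^+ 2) / s t ^+ 2).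
  by rewrite /F'; field; rewrite gt_eqF.
by rewrite -cs1; field; rewrite gt_eqF.
Qed.

(** The critical case [w * l ^+ 2 = pi ^+ 2] has no slack for the cotangent argument. It follows
    from the strict version with [k = (1 - e) * Num.sqrt w] as e tends to 0. *)
Lemma poincare (al l w : R) (f g : R -> R) :
  0 <= l -> 0 <= w -> w * l ^+ 2 <= pi ^+ 2 ->
  continuous g -> (forall t : R, is_derive t (1 : R) f (g t)) ->
  (forall t, ~~ (al <= t <= al + l) -> f t = 0) ->
  (\int[mu]_t (w * f t ^+ 2)%:E <= \int[mu]_t (g t ^+ 2)%:E)%E.
Proof.
move=> l0; rewrite le_eqVlt => /predU1P[<- _ _ _ _|w0 wl cg df f0].
  rewrite (_ : (\int[mu]_t _)%E = 0%E); last first.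
    by apply: integral0_eq => t _; rewrite mul0r.
  by apply: integral_ge0 => t _; rewrite lee_fin sqr_ge0.
have cf : continuous f by move=> t; exact: is_derive1_continuous (df t).
set B := (X in (_ <= X)%E).
have B0 : (0 <= B)%E by apply: integral_ge0 => t _; rewrite lee_fin sqr_ge0.
have if2 (c : R) : 0 <= c -> (\int[mu]_t (c * f t ^+ 2)%:E =
    c%:E * \int[mu]_t (f t ^+ 2)%:E)%E.
  move=> c0; under eq_integral do rewrite EFinM.
  rewrite ge0_integralZl//.
  - apply/measurable_EFinP; apply: continuous_measurable_fun => t.
    exact: (cvgM (cf t) (cf t)).
  - by move=> t _; rewrite lee_fin sqr_ge0.
have H (e : R) : 0 < e -> e < 1 ->
    (((1 - e) ^+ 2 * w)%:E * \int[mu]_t (f t ^+ 2)%:E <= B)%E.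
  move=> e0 e1; rewrite -if2; last by rewrite mulr_ge0// ?sqr_ge0// ltW.
  have := @poincare_strict al l ((1 - e) * Num.sqrt w) f g l0.
  rewrite exprMn sqr_sqrtr ?(ltW w0)//; apply => //.
    by rewrite mulr_gt0 ?sqrtr_gt0// subr_gt0.
  rewrite -mulrA; have : Num.sqrt w * l <= pi.
    rewrite -(@ler_pXn2r _ 2)// ?nnegrE ?pi_ge0 ?mulr_ge0 ?sqrtr_ge0//.
    by rewrite exprMn sqr_sqrtr// ltW.
  have := pi_gt0 R; nra.
rewrite if2 ?(ltW w0)//.
have [Boo|Bfin] := eqVneq B +oo%E; first by rewrite Boo leey.
have : (\int[mu]_t (f t ^+ 2)%:E \is a fin_num)%E.
  rewrite ge0_fin_numE; last by apply: integral_ge0 => t _; rewrite lee_fin sqr_ge0.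
  rewrite ltNge; apply/negP; rewrite leye_eq => /eqP fy.
  (* If the integral of [f ^+ 2] were infinite, any single e, here 1/2, would make [B] infinite. *)
  have := H (1 / 2) ltac:(lra) ltac:(lra).
  rewrite fy gt0_muley ?leye_eq ?(negPf Bfin)// lte_fin mulr_gt0// exprn_gt0//; lra.
move=> /fineK Af; have /fineK Bf : B \is a fin_num by rewrite ge0_fin_numE// lt_neqAle Bfin leey.
move: H; rewrite -Af -Bf => H; rewrite -EFinM lee_fin.
set A := fine _ in H *; set b := fine B in H *.
have A0 : 0 <= A.
  by apply: fine_ge0; apply: integral_ge0 => t _; rewrite lee_fin sqr_ge0.
apply/ler_addgt0Pr => e e0.
(* Since (1 - d)^2 >= 1 - 2d, the loss is at most [2 * d * (w * A)], which this choice keeps below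
   [e]. *)
pose d := Num.min (1 / 2) (e / (2 * (w * A + 1))).
have wA : 0 <= w * A by rewrite mulr_ge0// ltW.
have d0 : 0 < d by rewrite lt_min divr_gt0//= divr_gt0// mulr_gt0//; lra.
have d1 : d <= 1 / 2 by rewrite ge_min lexx.
have d2 : d * (2 * (w * A + 1)) <= e.
  by rewrite -ler_pdivlMr ?ge_min ?lexx ?orbT// mulr_gt0//; lra.
have := H d d0 ltac:(lra); rewrite -EFinM lee_fin.
nra.
Qed.
End Poincare.

(** * Square integrable functions *)

Section L2.
Context {R : realType}.
Implicit Types (W : set (borel_plane R)) (f g : R * R -> R).

Lemma normLp2_sqr W f : measurable W ->
  (normLp W 2 f `^ 2 = \int[leb2 R]_(x in W) (f x ^+ 2)%:E)%E.
Proof.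
move=> mW; rewrite /normLp powR_Lnorm// [RHS]integral_mkcond.
apply: eq_integral => x _ /=; rewrite !patchE; case: ifPn => _ /=.
  by rewrite powR_mulrn ?normr_ge0// real_normK// num_real.
by rewrite normr0 powR0// .
Qed.

Lemma in_L2P W f : measurable W ->
  in_L2 W f <-> measurable_fun W f /\
    (leb2 R).-integrable W (fun x => (f x ^+ 2)%:E).
Proof.
move=> mW; split => [[mf Nf]|[mf /integrableP[_ If]]]; split => //.
  apply/integrableP; split; first by apply/measurable_EFinP; exact: measurable_funX.
  under eq_integral do rewrite /= ger0_norm ?sqr_ge0//.
  by rewrite -normLp2_sqr// poweR_lty.
apply: (@lty_poweRy _ _ 2); rewrite ?pnatr_eq0//.
rewrite normLp2_sqr//; move: If.
by under eq_integral do rewrite /= ger0_norm ?sqr_ge0//.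
Qed.

Lemma normLp2_cvg0 W (f : nat -> R * R -> R) (e : R) : measurable W -> 0 < e ->
  (fun k => normLp W 2 (f k)) @ \oo --> 0%E ->
  \forall k \near \oo, (\int[leb2 R]_(x in W) (f k x ^+ 2)%:E <= e%:E)%E.
Proof.
move=> mW e0 /fine_cvgP[fin cv].
have se0 : 0 < Num.sqrt e by rewrite sqrtr_gt0.
near=> k.
have fk : normLp W 2 (f k) \is a fin_num by near: k.
rewrite -normLp2_sqr// -(fineK fk) poweR_EFin lee_fin powR_mulrn; last first.
  by rewrite fine_ge0// Lnorm_ge0.
rewrite -(sqr_sqrtr (ltW e0)) ler_sqr ?nnegrE ?sqrtr_ge0//.
  near: k; exact: (cvgr_le 0 cv).
by rewrite fine_ge0// Lnorm_ge0.
Unshelve. all: by end_near. Qed.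

Lemma integrable_mul_sqr W f g : measurable W ->
  measurable_fun W f -> measurable_fun W g ->
  (leb2 R).-integrable W (fun x => (f x ^+ 2)%:E) ->
  (leb2 R).-integrable W (fun x => (g x ^+ 2)%:E) ->
  (leb2 R).-integrable W (EFin \o (fun x => f x * g x)).
Proof.
move=> mW mf mg if2 ig2.
apply: (le_integrable mW _ _ (integrableD mW if2 ig2)).
  by apply/measurable_EFinP; exact: measurable_funM.
move=> x _ /=; rewrite lee_fin [leRHS]ger0_norm ?addr_ge0 ?sqr_ge0//.
by rewrite ler_norml; apply/andP; split; nra.
Qed.

Lemma in_L2_integrable_mul W f g : measurable W -> in_L2 W f -> in_L2 W g ->
  (leb2 R).-integrable W (EFin \o (fun x => f x * g x)).
Proof. by move=> mW /in_L2P[]// ? ? /in_L2P[]// ? ?; exact: integrable_mul_sqr. Qed.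

Lemma in_L2_test W phi : measurable W -> test_function W phi -> in_L2 W phi.
Proof.
move=> mW tp; apply/in_L2P => //.
have cp := test_function_continuous tp.
split; first exact: continuous_plane_measurable.
have [r r0 br] := test_function_box tp.
apply: (integrableS measurableT) => //.
apply: (@box_supported_integrable _ r (fun x => phi x ^+ 2)).
  by move=> x; apply: (cvgM (cp x) (cp x)).
by move=> x /br ->; rewrite expr0n.
Qed.

Lemma normLp0 W p : p != 0 -> normLp W p (fun _ => 0) = 0%E.
Proof.
move=> p0; rewrite /normLp.
have -> : EFin \o ((fun=> 0 : R) \_ W) = cst 0%E.
  by apply/funext => x /=; rewrite patchE; case: ifP.
by rewrite Lnorm0// eqe.
Qed.

(** A constant approximating sequence suffices. This makes test functions admissible in the weak
    form of the eigenvalue equation. *)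
Lemma H10_test W phi : measurable W -> test_function W phi ->
  H10 W phi (d1 phi) (d2 phi).
Proof.
move=> mW tp; have t1 := test_function_d1 tp; have t2 := test_function_d2 tp.
split.
  split; try exact: in_L2_test.
  by move=> psi tq; split; [exact: test_function_ibp1|exact: test_function_ibp2].
exists (fun=> phi).
have z (f : R * R -> R) : (fun _ : nat => normLp W 2 (f \- f)) @ \oo --> 0%E.
  have -> : f \- f = (fun=> 0) by apply/funext => x /=; rewrite subrr.
  by rewrite normLp0 ?pnatr_eq0//; exact: cvg_cst.
by split.
Qed.

(** Young's inequality f^2 <= (1 + t) g^2 + (1 + 1/t) (f - g)^2, integrated against a weight. It
    replaces the triangle inequality in a weighted L^2 space and holds in the extended reals without
    any integrability. *)
Lemma integral_sqr_approx W (w f g : R * R -> R) (t : R) : 0 < t ->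
  measurable W -> measurable_fun W w -> (forall x, W x -> 0 <= w x) ->
  measurable_fun W f -> measurable_fun W g ->
  (\int[leb2 R]_(x in W) (w x * f x ^+ 2)%:E <=
   (1 + t)%:E * \int[leb2 R]_(x in W) (w x * g x ^+ 2)%:E +
   (1 + t^-1)%:E * \int[leb2 R]_(x in W) (w x * (f x - g x) ^+ 2)%:E)%E.
Proof.
move=> t0 mW mw w0 mf mg.
have ti : 0 < t^-1 by rewrite invr_gt0.
have mwg : measurable_fun W (fun x => w x * g x ^+ 2).
  by apply: measurable_funM => //; exact: measurable_funX.
have mwfg : measurable_fun W (fun x => w x * (f x - g x) ^+ 2).
  apply: measurable_funM => //; apply: measurable_funX; exact: measurable_funB.
have wg0 x : W x -> (0 <= (w x * g x ^+ 2)%:E)%E.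
  by move=> Wx; rewrite lee_fin mulr_ge0 ?sqr_ge0 ?w0.
have wfg0 x : W x -> (0 <= (w x * (f x - g x) ^+ 2)%:E)%E.
  by move=> Wx; rewrite lee_fin mulr_ge0 ?sqr_ge0 ?w0.
rewrite -!ge0_integralZl//; try (by rewrite lee_fin; lra);
  try exact/measurable_EFinP.
rewrite -ge0_integralD//; last 4 first.
- by move=> x Wx; rewrite mule_ge0 ?wg0// lee_fin; lra.
- by apply: measurable_funeM; exact/measurable_EFinP.
- by move=> x Wx; rewrite mule_ge0 ?wfg0// lee_fin; lra.
- by apply: measurable_funeM; exact/measurable_EFinP.
apply: ge0_le_integral => //.
- by move=> x Wx; rewrite lee_fin mulr_ge0 ?sqr_ge0 ?w0.
- by apply/measurable_EFinP; apply: measurable_funM => //; exact: measurable_funX.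
- by apply: emeasurable_funD; apply: measurable_funeM; exact/measurable_EFinP.
move=> x Wx; rewrite -!EFinM -EFinD lee_fin.
set a := f x; set b := g x; set v := w x.
have -> : (1 + t) * (v * b ^+ 2) + (1 + t^-1) * (v * (a - b) ^+ 2) =
  v * (a ^+ 2 + t^-1 * (t * b - (a - b)) ^+ 2).
  by field; rewrite gt_eqF.
by apply: ler_wpM2l; [exact: w0|rewrite lerDl mulr_ge0 ?sqr_ge0 ?(ltW ti)].
Qed.
End L2.

(** * The Poincare inequality on slices *)

Section PDE.
Context {R : realType}.
Implicit Types (W : set (borel_plane R)) (f g : R * R -> R).
Notation mu := (@lebesgue_measure R).

(** The slice over [x] lies in an interval of length [l] whose first Dirichlet eigenvalue pi^2/l^2
    is at least [w x]. The product form allows [l = 0], used for empty slices. *)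
Definition slices_bounded W (w : R -> R) := forall x, exists al l, [/\ 0 <= l,
  w x * l ^+ 2 <= pi ^+ 2 & forall y, W (x, y) -> al <= y <= al + l].

(** Tonelli with the vertical variable innermost reduces the claim to [poincare] on each slice, with
    the constant [w x] of that slice. *)
Lemma test_poincare W (w : R -> R) phi : test_function W phi ->
  continuous w -> (forall x, 0 <= w x) -> slices_bounded W w ->
  (\int[leb2 R]_z (w z.1 * phi z ^+ 2)%:E <=
   \int[leb2 R]_z (d2 phi z ^+ 2)%:E)%E.
Proof.
move=> tp cw w0 sl.
have cp := test_function_continuous tp.
have cd := test_function_continuous (test_function_d2 tp).
have m1 : measurable_fun (setT : set (borel_plane R))
    (fun z => (w z.1 * phi z ^+ 2)%:E).
  apply/measurable_EFinP; apply: continuous_plane_measurable => [|z].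
    exact: measurableT.
  apply: cvgM; last exact: (cvgM (cp z) (cp z)).
  by apply: (@continuous_comp _ _ _ fst w); [exact: cvg_fst|exact: cw].
have m2 : measurable_fun (setT : set (borel_plane R))
    (fun z => (d2 phi z ^+ 2)%:E).
  apply/measurable_EFinP; apply: continuous_plane_measurable => [|z].
    exact: measurableT.
  exact: (cvgM (cd z) (cd z)).
have n1 (z : borel_plane R) : (0 <= (w z.1 * phi z ^+ 2)%:E)%E.
  by rewrite lee_fin mulr_ge0// sqr_ge0.
have n2 (z : borel_plane R) : (0 <= (d2 phi z ^+ 2)%:E)%E.
  by rewrite lee_fin sqr_ge0.
rewrite [leLHS](fubini_tonelli1 (m1 := mu) (m2 := mu) _ m1 n1).
rewrite [leRHS](fubini_tonelli1 (m1 := mu) (m2 := mu) _ m2 n2).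
apply: ge0_le_integral => //.
- by move=> x _; apply: integral_ge0.
- exact: measurable_fun_fubini_tonelli_F.
- exact: measurable_fun_fubini_tonelli_F.
move=> x _; rewrite /fubini_F/=.
have [al [l [l0 wl sx]]] := sl x.
apply: (@poincare R al l (w x) (fun y => phi (x, y)) (fun y => d2 phi (x, y))) => //.
- move=> t; apply: (@continuous_comp _ _ _ (fun t => (x, t)) (d2 phi)).
    exact: continuous_pairr.
  exact: cd.
- move=> t; have [dt e] := derivable2_section (@test_function_derivable2 _ _ _ (x, t) tp).
  by apply: (DeriveDef dt); rewrite -derive1E.
- by move=> t /negP tn; apply: (test_function_eq0 tp) => /sx.
Qed.

(** Both [u] and [g2] are replaced by a test function and its derivative, and the errors are sent to
    0. The bound [C] on the weight turns convergence in L^2 into convergence in the weighted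
    norm. *)
Lemma H10_poincare W (w : R -> R) (C : R) u g1 g2 : measurable W -> H10 W u g1 g2 ->
  continuous w -> (forall x, 0 <= w x) -> slices_bounded W w ->
  (forall z, W z -> w z.1 <= C) ->
  (\int[leb2 R]_(z in W) (w z.1 * u z ^+ 2)%:E <=
   \int[leb2 R]_(z in W) (g2 z ^+ 2)%:E)%E.
Proof.
move=> mW [[/in_L2P[]// mu' iu _ /in_L2P[]// mg2 ig2 _] [phi [tp cu _ cg]]] cw w0 sl wC.
set B := (X in (_ <= X)%E).
have B0 : (0 <= B)%E.
  by apply: integral_ge0 => z _; rewrite lee_fin sqr_ge0.
have Bfin : B \is a fin_num.
  exact: integrable_fin_num.
have mw : measurable_fun W (fun z => w z.1).
  apply: continuous_plane_measurable => // z.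
  by apply: (@continuous_comp _ _ _ fst w); [exact: cvg_fst|exact: cw].
(* [C] need not be positive when [W] is empty; [D] is. *)
pose D := Num.max C 1.
have D0 : 0 < D by rewrite lt_max ltr01 orbT.
have key (t e : R) : 0 < t -> 0 < e ->
    (\int[leb2 R]_(z in W) (w z.1 * u z ^+ 2)%:E <=
     (1 + t)%:E * ((1 + t)%:E * B +
       (1 + t^-1)%:E * e%:E) + (1 + t^-1)%:E * (D * e)%:E)%E.
  move=> t0 e0.
  have [k [ku kg]] := filter_ex (filterI (normLp2_cvg0 mW e0 cu) (normLp2_cvg0 mW e0 cg)).
  have mphi : measurable_fun W (phi k).
    by apply: continuous_plane_measurable (test_function_continuous (tp k)).
  have mdphi : measurable_fun W (d2 (phi k)).
    by apply: continuous_plane_measurable (test_function_continuous (test_function_d2 (tp k))).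
  apply: (le_trans (integral_sqr_approx t0 mW mw _ mu' mphi)); first by [].
  have t1 : (0 <= (1 + t)%:E)%E by rewrite lee_fin; lra.
  have t2 : (0 <= (1 + t^-1)%:E)%E by rewrite lee_fin addr_ge0// invr_ge0 ltW.
  apply: leeD; apply: lee_wpmul2l => //.
    have e1 : (\int[leb2 R]_(z in W) (w z.1 * phi k z ^+ 2)%:E =
        \int[leb2 R]_z (w z.1 * phi k z ^+ 2)%:E)%E.
      rewrite integral_mkcond; apply: eq_integral => z _; rewrite patchE.
      case: ifPn => // /negP; rewrite inE => /(test_function_eq0 (tp k)) ->.
      by rewrite expr0n mulr0.
    have e2 : (\int[leb2 R]_(z in W) (d2 (phi k) z ^+ 2)%:E =
        \int[leb2 R]_z (d2 (phi k) z ^+ 2)%:E)%E.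
      rewrite integral_mkcond; apply: eq_integral => z _; rewrite patchE.
      case: ifPn => // /negP; rewrite inE.
      by move=> /(test_function_eq0 (test_function_d2 (tp k))) ->; rewrite expr0n.
    have := test_poincare (tp k) cw w0 sl; rewrite -e1 -e2.
    move=> /le_trans; apply.
    have := @integral_sqr_approx _ W (cst 1) (d2 (phi k)) g2 t t0 mW
      (measurable_cst _) (fun _ _ => ler01) mdphi mg2.
    rewrite /cst; under eq_integral do rewrite mul1r.
    move=> /le_trans; apply; apply: leeD; apply: lee_wpmul2l => //.
      by under eq_integral do rewrite mul1r.
    by under eq_integral do rewrite mul1r -sqrrN opprB.
  apply: (@le_trans _ _ (D%:E * \int[leb2 R]_(z in W) ((u z - phi k z) ^+ 2)%:E)%E).
    have md : measurable_fun W (fun z => (u z - phi k z) ^+ 2).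
      by apply: measurable_funX; exact: measurable_funB.
    rewrite -ge0_integralZl//; last 3 first.
    - exact/measurable_EFinP.
    - by move=> z _; rewrite lee_fin sqr_ge0.
    - by rewrite lee_fin ltW.
    apply: ge0_le_integral => //.
    - by move=> z _; rewrite lee_fin mulr_ge0// sqr_ge0.
    - by apply/measurable_EFinP; exact: measurable_funM.
    - by apply: measurable_funeM; exact/measurable_EFinP.
    move=> z Wz; rewrite -EFinM lee_fin ler_wpM2r ?sqr_ge0//.
    by rewrite le_max wC.
  by rewrite EFinM; apply: lee_wpmul2l => //; rewrite lee_fin ltW.
set A := integral _ _ _ in key *.
have A0 : (0 <= A)%E.
  by apply: integral_ge0 => z _; rewrite lee_fin mulr_ge0// sqr_ge0.
have /fineK Bf := Bfin.
set b := fine B in Bf.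
have {}key t e : 0 < t -> 0 < e -> (A <=
    ((1 + t) * ((1 + t) * b + (1 + t^-1) * e) + (1 + t^-1) * (D * e))%:E)%E.
  by move=> t0 e0; have := key t e t0 e0; rewrite -Bf.
have Af : A \is a fin_num.
  by rewrite ge0_fin_numE//; apply: (le_lt_trans (key 1 1 ltr01 ltr01)); rewrite ltry.
move: key B0; rewrite -Bf -(fineK Af); set a := fine A.
move=> key; rewrite !lee_fin => b0.
apply/ler_addgt0Pr => e e0.
(* The order of choices matters: [t] first, so that the factor (1 + t)^2 costs at most [e / 2], then
   the approximation error [e / 2 / K], where [K] depends on [t] and collects the coefficients of
   that error. *)
have [t [t0 te]] : exists t, 0 < t /\ (1 + t) ^+ 2 * b <= b + e / 2.
  exists (Num.min 1 (e / (6 * (b + 1)))).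
  set t := Num.min _ _.
  have t1 : t <= 1 by rewrite ge_min lexx.
  have t0 : 0 < t by rewrite lt_min ltr01 divr_gt0// mulr_gt0//; lra.
  have : t * (6 * (b + 1)) <= e.
    by rewrite -ler_pdivlMr ?ge_min ?lexx ?orbT// mulr_gt0//; lra.
  by split => //; nra.
have ti : 0 < t^-1 by rewrite invr_gt0.
pose K := (1 + t) * (1 + t^-1) + (1 + t^-1) * D.
have K0 : 0 < K by rewrite addr_gt0// mulr_gt0//; lra.
have eK : 0 < e / 2 / K by rewrite !divr_gt0.
have := key t (e / 2 / K) t0 eK; rewrite lee_fin.
have -> : (1 + t) * ((1 + t) * b + (1 + t^-1) * (e / 2 / K)) +
  (1 + t^-1) * (D * (e / 2 / K)) = (1 + t) ^+ 2 * b + K * (e / 2 / K).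
  by rewrite /K; ring.
have -> : K * (e / 2 / K) = e / 2 by rewrite mulrC divfK// gt_eqF.
lra.
Qed.
End PDE.

(** * Bounds for the first eigenvalue *)

Section Eigen.
Context {R : realType}.
Implicit Types (W : set (borel_plane R)) (f g : R * R -> R).

Lemma integral2D W f g : measurable W -> (leb2 R).-integrable W (EFin \o f) ->
  (leb2 R).-integrable W (EFin \o g) ->
  integral2 W (fun x => f x + g x) = integral2 W f + integral2 W g.
Proof. exact: RintegralD. Qed.

Lemma integral2Z W f (k : R) : measurable W ->
  (leb2 R).-integrable W (EFin \o f) ->
  integral2 W (fun x => k * f x) = k * integral2 W f.
Proof. by move=> mW; exact: RintegralZl. Qed.

Lemma normLp2_eq1 W u : measurable W -> normLp W 2 u = 1%E ->
  (\int[leb2 R]_(z in W) (u z ^+ 2)%:E = 1)%E.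
Proof. by move=> mW N1; rewrite -normLp2_sqr// N1 poweR_EFin powR1. Qed.

(** Testing the equation with [u] itself gives lambda as the integral of |Du|^2; the horizontal part
    is dropped and the vertical part is bounded below by the slice inequality. *)
Lemma eigenvalue_ge W (w : R -> R) (C lambda : R) u : measurable W ->
  dirichlet_eigenfunction W lambda u -> normLp W 2 u = 1%E ->
  continuous w -> (forall x, 0 <= w x) -> slices_bounded W w ->
  (forall z, W z -> w z.1 <= C) ->
  (\int[leb2 R]_(z in W) (w z.1 * u z ^+ 2)%:E <= lambda%:E)%E.
Proof.
move=> mW [_ [_ [g1 [g2 [Hu weak]]]]] N1 cw w0 sl wC.
apply: (le_trans (H10_poincare mW Hu cw w0 sl wC)).
have [[L2u /in_L2P[]// m1 i1 /in_L2P[]// m2 i2 _] _] := Hu.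
have u1 := normLp2_eq1 mW N1.
have [mu' iu] := (in_L2P u mW).1 L2u.
have := weak u g1 g2 Hu; rewrite /integral2.
have -> : \int[leb2 R]_(x in W) (lambda * u x * u x) = lambda.
  transitivity (\int[leb2 R]_(x in W) (lambda * u x ^+ 2)).
    by apply: eq_Rintegral => x _; ring.
  by rewrite RintegralZl// /Rintegral u1 mulr1.
move=> <-.
have -> : \int[leb2 R]_(x in W) (g1 x * g1 x + g2 x * g2 x) =
    \int[leb2 R]_(x in W) (g1 x ^+ 2) + \int[leb2 R]_(x in W) (g2 x ^+ 2).
  by rewrite -RintegralD.
rewrite EFinD /Rintegral !fineK; try exact: integrable_fin_num.
by apply: leeDr; apply: integral_ge0 => x _; rewrite lee_fin sqr_ge0.
Qed.

(** The equation is tested with [phi], and the definition of the weak gradient is then applied to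
    the test functions [d1 phi] and [d2 phi]. This gives lambda times the integral of u phi as the
    integral of u (-Lap phi), and the comparison divides by the positive integral of u phi. *)
Lemma eigenvalue_le W (lambda mu : R) u phi : measurable W ->
  dirichlet_eigenfunction W lambda u ->
  {ae leb2 R, forall x, W x -> 0 < u x} ->
  test_function W phi -> (forall x, 0 <= phi x) ->
  ~ {ae leb2 R, forall x, W x -> phi x = 0} ->
  (forall x, - (d1 (d1 phi) x + d2 (d2 phi) x) <= mu * phi x) ->
  lambda <= mu.
Proof.
move=> mW [_ [_ [g1 [g2 [Hu weak]]]]] upos tp p0 pn0 lap.
have t1 := test_function_d1 tp; have t2 := test_function_d2 tp.
have t11 := test_function_d1 t1; have t22 := test_function_d2 t2.
have [[L2u L1 L2 ibp] _] := Hu.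
have iup := in_L2_integrable_mul mW L2u (in_L2_test mW tp).
have iu11 := in_L2_integrable_mul mW L2u (in_L2_test mW t11).
have iu22 := in_L2_integrable_mul mW L2u (in_L2_test mW t22).
have ig1 := in_L2_integrable_mul mW L1 (in_L2_test mW t1).
have ig2 := in_L2_integrable_mul mW L2 (in_L2_test mW t2).
have [mu' _] := (in_L2P u mW).1 L2u.
have := weak phi _ _ (H10_test mW tp).
have -> : integral2 W (fun x => g1 x * d1 phi x + g2 x * d2 phi x) =
    integral2 W (fun x => g1 x * d1 phi x) + integral2 W (fun x => g2 x * d2 phi x).
  exact: (integral2D mW ig1 ig2).
have [e1 _] := ibp _ t1; have [_ e2] := ibp _ t2.
have -> : integral2 W (fun x => lambda * u x * phi x) =
    lambda * integral2 W (fun x => u x * phi x).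
  rewrite -(integral2Z lambda mW iup).
  by apply: eq_Rintegral => x _; rewrite mulrA.
move=> eqn.
(* [u] is positive only almost everywhere, so such integrals are rewritten with absolute values.
   This gives their sign, and for [phi] a zero integral would force [u * phi = 0], hence [phi = 0],
   almost everywhere on [W]. *)
have nonneg (psi : R * R -> R) :
    (forall x, 0 <= psi x) ->
    (leb2 R).-integrable W (EFin \o (fun x => u x * psi x)) ->
    integral2 W (fun x => u x * psi x) =
    fine (\int[leb2 R]_(x in W) `|(u x * psi x)%:E|)%E.
  move=> ps0 ips; rewrite /integral2 /Rintegral; congr fine.
  apply: ae_eq_integral => //.
  - exact: measurable_int ips.
  - by apply: measurableT_comp => //; exact: measurable_int ips.
  apply: filterS upos => x ux Wx /=.
  by rewrite ger0_norm// mulr_ge0// ltW// ux.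
have A0 : 0 < integral2 W (fun x => u x * phi x).
  rewrite nonneg//.
  rewrite lt0r fine_ge0 ?andbT; last exact: integral_ge0.
  apply/eqP => z; apply: pn0.
  have : (\int[leb2 R]_(x in W) `|(u x * phi x)%:E| = 0)%E.
    by rewrite -[LHS]fineK ?z//; apply: integrable_fin_num => //; exact: integrable_abse.
  move=> /(ae_eq_integral_abs _ mW (measurable_int _ iup)) aez.
  apply: filterS2 upos aez => x ux /= /[swap] Wx /(_ Wx) [/eqP].
  by rewrite mulf_eq0 (gt_eqF (ux Wx)) => /eqP.
pose psi x := mu * phi x + (d1 (d1 phi) x + d2 (d2 phi) x).
have psi0 x : 0 <= psi x by rewrite /psi -[X in _ <= _ + X]opprK subr_ge0.
have imup : (leb2 R).-integrable W (EFin \o (fun x => mu * (u x * phi x))).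
  by apply: (integrableZl mW mu iup).
have i12 : (leb2 R).-integrable W
    (EFin \o (fun x => u x * d1 (d1 phi) x + u x * d2 (d2 phi) x)).
  exact: (integrableD mW iu11 iu22).
have ips : (leb2 R).-integrable W (EFin \o (fun x => u x * psi x)).
  have := integrableD mW imup i12; apply: eq_integrable => // x _.
  by rewrite /= /psi -EFinD; congr EFin; ring.
have : 0 <= integral2 W (fun x => u x * psi x).
  rewrite nonneg//.
  by apply: fine_ge0; exact: integral_ge0.
have -> : integral2 W (fun x => u x * psi x) =
  mu * integral2 W (fun x => u x * phi x) +
  (integral2 W (fun x => u x * d1 (d1 phi) x) +
   integral2 W (fun x => u x * d2 (d2 phi) x)).
  rewrite -(integral2Z mu mW iup) -(integral2D mW iu11 iu22).
  rewrite -(integral2D mW imup i12).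
  by apply: eq_Rintegral => x _; rewrite /psi; ring.
move: e1 e2 eqn A0.
generalize (integral2 W (fun x => u x * phi x))
  (integral2 W (fun x => g1 x * d1 phi x)) (integral2 W (fun x => g2 x * d2 phi x))
  (integral2 W (fun x => u x * d1 (d1 phi) x))
  (integral2 W (fun x => u x * d2 (d2 phi) x)).
move=> A I1 I2 J1 J2 e1 e2 eqn A0 h; rewrite -subr_ge0 -(pmulr_lge0 _ A0) mulrBl.
lra.
Qed.
End Eigen.

(** * Smooth profiles *)

Section Smooth.
Context {R : realType}.
Implicit Types (f g p q : R -> R).

(** One-variable counterpart of [Ck]. The derivative is a witness rather than a value of the
    derivation operator, so explicit formulas can be supplied. *)
Fixpoint C1k (k : nat) f : Prop :=
  if k is k'.+1 then
    exists2 g : R -> R, (forall x : R, is_derive x (1 : R) f (g x)) & C1k k' g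
  else continuous f.

Lemma C1k_continuous k f : C1k k f -> continuous f.
Proof.
by case: k => [//|k [g df _]] x; exact: is_derive1_continuous (df x).
Qed.

Lemma C1k_pred k f : C1k k.+1 f -> C1k k f.
Proof.
elim: k f => [|k IH] f; first exact: C1k_continuous.
by move=> [g df cg]; exists g => //; exact: IH.
Qed.

Lemma C1k_cst k (c : R) : C1k k (fun _ => c).
Proof.
elim: k c => [|k IH] c; first exact: cst_continuous.
by exists (fun=> 0) => // x; exact: is_derive_cst.
Qed.

Lemma C1k_add k f g : C1k k f -> C1k k g -> C1k k (fun x => f x + g x).
Proof.
elim: k f g => [|k IH] f g; first by move=> cf cg x; apply: cvgD; [exact: cf|exact: cg].
move=> [f' df cf] [g' dg cg]; exists (fun x => f' x + g' x); last exact: IH.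
by move=> x; exact: is_derive1_add.
Qed.

Lemma C1k_mul k f g : C1k k f -> C1k k g -> C1k k (fun x => f x * g x).
Proof.
elim: k f g => [|k IH] f g; first by move=> cf cg x; apply: cvgM; [exact: cf|exact: cg].
move=> cf' cg'; have cf := C1k_pred cf'; have cg := C1k_pred cg'.
move: cf' cg' => [f' df cf'] [g' dg cg'].
exists (fun x => f' x * g x + f x * g' x).
  by move=> x; exact: is_derive1_mul.
by apply: C1k_add; exact: IH.
Qed.

Lemma C1k_comp k f g : C1k k f -> C1k k g -> C1k k (fun x => g (f x)).
Proof.
elim: k f g => [|k IH] f g.
  by move=> cf cg x; apply: continuous_comp; [exact: cf|exact: cg].
move=> cf' cg'; have cf := C1k_pred cf'.
move: cf' cg' => [f' df cf'] [g' dg cg'].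
exists (fun x => g' (f x) * f' x); first by move=> x; exact: is_derive1_comp.
by apply: C1k_mul => //; exact: IH.
Qed.

Lemma C1k_affine k (a c : R) : C1k k (fun x => a * (x - c)).
Proof.
case: k => [|k]; last first.
  exists (fun=> a); last exact: C1k_cst.
  by move=> x; exact: is_derive1_affine.
by move=> x; exact: is_derive1_continuous (is_derive1_affine a c x).
Qed.

(** Sine and cosine are treated together, and with a coefficient, because differentiation exchanges
    them and changes a sign. *)
Lemma C1k_sin_cos k (c : R) : C1k k (fun x => c * sin x) /\ C1k k (fun x => c * cos x).
Proof.
elim: k c => [|k IH] c.
  split=> x; apply: cvgM; try exact: cvg_cst;
    [exact: continuous_sin|exact: continuous_cos].
split.
  exists (fun x => c * cos x); last exact: (IH c).2.
  move=> x; apply: (is_derive_eq (is_derive1_mul (is_derive_cst c x 1) (is_derive_sin x))).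
  by rewrite mul0r add0r.
exists (fun x => - c * sin x); last exact: (IH _).1.
move=> x; apply: (is_derive_eq (is_derive1_mul (is_derive_cst c x 1) (is_derive_cos x))).
by rewrite mul0r add0r mulrN mulNr.
Qed.

Lemma is_derive1_near (f g : R -> R) (x d : R) :
  (\forall y \near x, f y = g y) -> is_derive x (1 : R) g d ->
  is_derive x (1 : R) f d.
Proof.
move=> fg [dg <-]; apply: DeriveDef; last exact: near_eq_derive.
by apply: near_eq_derivable dg; apply: filterS fg => y ->.
Qed.

(** The bound forces [f 0 = 0] and makes the difference quotient at 0 at most C |h|. It serves to
    differentiate [flat] at the origin. *)
Lemma is_derive1_sqr_bound (f : R -> R) (C : R) : (forall x, `|f x| <= C * x ^+ 2) ->
  is_derive (0 : R) (1 : R) f 0.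
Proof.
move=> fC.
have f0 : f 0 = 0.
  by apply/eqP; rewrite -normr_le0; have := fC 0; rewrite expr0n/= mulr0.
have C0 : 0 <= C by have := le_trans (normr_ge0 _) (fC 1); rewrite expr1n mulr1.
have cv : h^-1 *: ((f \o shift 0) (h *: (1 : R)) - f 0) @[h --> 0^'] --> (0 : R).
  apply/cvgrPdist_le => /= e e0; near=> h.
  have h0 : h != 0 by near: h; exact: nbhs_dnbhs_neq.
  rewrite sub0r normrN f0 subr0 addr0 /GRing.scale/= mulr1 normrM normfV.
  rewrite ler_pdivrMl ?normr_gt0//; apply: (le_trans (fC h)).
  have : `|h| <= e / (C + 1).
    near: h; apply: dnbhs0_le; rewrite divr_gt0//; lra.
  rewrite ler_pdivlMr; last lra.
  rewrite -real_normK ?num_real//; have := normr_ge0 h.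
  move: (`|h|) => t t0 te; nra.
apply: DeriveDef; first by apply/cvg_ex; exists 0.
by apply: cvg_lim => //.
Unshelve. all: by end_near. Qed.

(* These functions are stable under differentiation, also at the origin, which
   gives their smoothness by induction. *)
Definition flat (eta : R) (n : nat) (s : R) : R :=
  if 0 < s then s ^- n * expR (- eta / s) else 0.

(** From e^x >= 1 + x >= x follows exp(-m x) <= x^-m. With m = n + 2 and x = eta / (s m), the factor
    s^m beats s^-n and leaves s^2. *)
Lemma flat_bound (eta : R) n : 0 < eta ->
  exists C, forall s, `|flat eta n s| <= C * s ^+ 2.
Proof.
move=> e0; pose m := n.+2; exists ((m%:R / eta) ^+ m) => s.
have me0 : 0 <= m%:R / eta by rewrite divr_ge0// ltW.
rewrite /flat; case: ifP => s0; last by rewrite normr0 mulr_ge0 ?sqr_ge0// exprn_ge0.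
rewrite ger0_norm; last by rewrite mulr_ge0 ?expR_ge0// invr_ge0 exprn_ge0// ltW.
rewrite ler_pdivrMl ?exprn_gt0// mulrCA -exprD addn2 -/m -exprMn.
pose x := eta / s / m%:R.
have x0 : 0 < x by rewrite !divr_gt0// ltr0n.
have -> : - eta / s = - (m%:R * x).
  by rewrite /x mulrCA divff ?mulr1 ?mulNr ?pnatr_eq0.
have -> : m%:R / eta * s = x^-1 by rewrite /x !invfM !invrK; ring.
rewrite expRN expRM_natl -exprVn lerXn2r ?nnegrE ?invr_ge0 ?expR_ge0//.
  exact: ltW.
rewrite lef_pV2 ?posrE ?expR_gt0//.
by apply: le_trans (expR_ge1Dx _); rewrite lerDr.
Qed.

Lemma is_derive1_flat (eta : R) n (s : R) : 0 < eta ->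
  is_derive s (1 : R) (flat eta n) (- n%:R * flat eta n.+1 s + eta * flat eta n.+2 s).
Proof.
move=> e0; have [s0|s0|->] := ltgtP s 0.
- rewrite /flat ltNge (ltW s0)/= !mulr0 addr0.
  apply: is_derive1_near (is_derive_cst 0 s 1).
  by apply: filterS (lt_nbhsl s0) => y y0; rewrite /= ltNge (ltW y0).
- rewrite /flat s0.
  have sn0 : s != 0 by rewrite gt_eqF.
  apply: (@is_derive1_near _ (fun y => (y ^+ n)^-1 * expR (- eta * y^-1))).
    by apply: filterS (gt_nbhsr s0) => y y0; rewrite /= y0.
  have dX : is_derive s (1 : R) (fun y => y ^+ n) (n%:R * s ^+ n.-1).
    have -> : (fun y : R => y ^+ n) = (id : R -> R) ^+ n by apply/funext => y; rewrite exprfctE.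
    by apply: is_derive_eq; rewrite /GRing.scale/= mulr1.
  have dXV := @is_derive1_inv R (fun y => y ^+ n) s _ (expf_neq0 n sn0) dX.
  have dV := @is_derive1_inv R id s _ sn0 (is_derive_id s 1).
  have dE := is_derive1_comp (is_derive_expR _) (is_derive1_mul (is_derive_cst (- eta) s 1) dV).
  apply: (is_derive_eq (is_derive1_mul dXV dE)).
  rewrite /cst/= mul0r add0r mulr1 !exprS.
  set X := expR _; case: n dX dXV => [|n] _ _ /=.
    by rewrite !expr0; field.
  by rewrite !exprS; field; rewrite expf_neq0// sn0.
- have [C bC] := flat_bound n e0.
  by rewrite /flat ltxx !mulr0 addr0; exact: is_derive1_sqr_bound bC.
Qed.

Lemma C1k_flat k (eta : R) n : 0 < eta -> C1k k (flat eta n).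
Proof.
move=> e0; elim: k n => [|k IH] n.
  by move=> s; exact: is_derive1_continuous (is_derive1_flat n s e0).
exists (fun s => - n%:R * flat eta n.+1 s + eta * flat eta n.+2 s).
  by move=> s; exact: is_derive1_flat.
by apply: C1k_add; apply: C1k_mul => //; exact: C1k_cst.
Qed.
End Smooth.

(** * Compactly supported smooth near-eigenfunctions of an interval *)

Section Profile.
Context {R : realType}.
Implicit Types (f g p q : R -> R).

(** The profile is a function of a sine and is positive again on other periods; the restriction
    keeps a single bump. *)
Definition restr (a b : R) g (x : R) := if a < x < b then g x else 0.

Lemma is_derive1_open0 (U : set R) g g' : open U -> (forall x, U x -> g x = 0) ->
  (forall x : R, is_derive x (1 : R) g (g' x)) -> forall x, U x -> g' x = 0.
Proof.
move=> oU g0 dg x Ux; have [_ <-] := dg x.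
have [_ -> //] : is_derive x (1 : R) g 0.
apply: is_derive1_near (is_derive_cst 0 x 1).
by apply: filterS (open_nbhs_nbhs (conj oU Ux)) => y; exact: g0.
Qed.

Lemma is_derive1_restr (a b : R) (U : set R) g g' : open U -> U a -> U b ->
  (forall x, U x -> g x = 0) -> (forall x : R, is_derive x (1 : R) g (g' x)) ->
  forall x : R, is_derive x (1 : R) (restr a b g) (restr a b g' x).
Proof.
move=> oU Ua Ub g0 dg x.
have z : (\forall y \near x, restr a b g y = 0) -> restr a b g' x = 0 ->
    is_derive x (1 : R) (restr a b g) (restr a b g' x).
  by move=> h ->; apply: is_derive1_near (is_derive_cst 0 x 1).
have zU : U x -> is_derive x (1 : R) (restr a b g) (restr a b g' x).
  move=> Ux; apply: z.
    apply: filterS (open_nbhs_nbhs (conj oU Ux)) => y /g0 gy.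
    by rewrite /restr gy; case: ifP.
  by rewrite /restr (is_derive1_open0 oU g0 dg Ux); case: ifP.
have [xa|ax|xa] := ltgtP x a; last by apply: zU; rewrite xa.
- apply: z; last by rewrite /restr (lt_gtF xa).
  by apply: filterS (lt_nbhsl xa) => y ya; rewrite /restr (lt_gtF ya).
have [xb|bx|xb] := ltgtP x b; last by apply: zU; rewrite xb.
- rewrite {2}/restr ax xb /=; apply: is_derive1_near (dg x).
  by apply: filterS2 (lt_nbhsl xb) (gt_nbhsr ax) => y yb ay; rewrite /restr ay yb.
- apply: z; last by rewrite /restr (lt_gtF bx) andbF.
  by apply: filterS (gt_nbhsr bx) => y yb; rewrite /restr (lt_gtF yb) andbF.
Qed.

(** The cut does no harm because [g], and with it every derivative, vanishes on an open set
    containing both cut points. One order is given up because continuity of the restriction is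
    deduced from its differentiability. *)
Lemma C1k_restr k (a b : R) (U : set R) g : open U -> U a -> U b ->
  (forall x, U x -> g x = 0) -> C1k k.+1 g -> C1k k (restr a b g).
Proof.
move=> oU Ua Ub; elim: k g => [|k IH] g g0 [g' dg cg].
  by move=> x; exact: is_derive1_continuous (is_derive1_restr oU Ua Ub g0 dg x).
exists (restr a b g'); first exact: is_derive1_restr oU Ua Ub g0 dg.
by apply: IH => //; exact: is_derive1_open0 oU g0 dg.
Qed.


(* Up to the factor exp(- eta / s), this is w E'(s) - (1 - w^2) E''(s) <=
   (1 + eps) E(s) for E(s) = s exp(- eta / s), i.e. - f'' <= (1 + eps) k^2 f for
   f = E(w - eta) and w = sin (k (x - al)). *)
Lemma profile_ineq (eps s : R) (eta := eps ^+ 2 / 15) (w := s + eta) :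
  0 < eps -> eps <= 1 -> 0 < s -> w <= 1 ->
  w * (1 + eta / s) - (1 - w ^+ 2) * (eta ^+ 2 / s ^+ 3) <= (1 + eps) * s.
Proof.
move=> e0 e1 s0 w1.
have eta0 : 0 < eta by rewrite divr_gt0// exprn_gt0.
have s30 : 0 < s ^+ 3 by rewrite exprn_gt0.
rewrite -(ler_pM2r s30).
have -> : (w * (1 + eta / s) - (1 - w ^+ 2) * (eta ^+ 2 / s ^+ 3)) * s ^+ 3 =
  s ^+ 4 + 2 * eta * s ^+ 3 + eta ^+ 2 * s ^+ 2 - (1 - w ^+ 2) * eta ^+ 2.
  by rewrite /w; field; rewrite gt_eqF.
have -> : (1 + eps) * s * s ^+ 3 = s ^+ 4 + eps * s ^+ 4 by ring.
have w0 : 0 < w by rewrite addr_gt0.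
have w2 : w ^+ 2 <= 1 by rewrite expr_le1// ltW.
(* For large s, [eps * s ^+ 4] absorbs both positive error terms, since [eta <= s]. For small s the
   convexity term [(1 - w ^+ 2) * eta ^+ 2] takes over. *)
have [h|h] := leP (3 * eta) (eps * s).
  have es : eta <= s by nra.
  have i1 : eta ^+ 2 * s ^+ 2 <= eta * s ^+ 3.
    have -> : eta ^+ 2 * s ^+ 2 = (eta * s ^+ 2) * eta by ring.
    have -> : eta * s ^+ 3 = (eta * s ^+ 2) * s by ring.
    by rewrite ler_wpM2l// mulr_ge0 ?sqr_ge0// ltW.
  have i2 : 3 * eta * s ^+ 3 <= eps * s ^+ 4.
    by rewrite (exprS s 3) mulrA ler_wpM2r// ltW.
  have i3 : 0 <= (1 - w ^+ 2) * eta ^+ 2 by rewrite mulr_ge0 ?sqr_ge0// subr_ge0.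
  lra.
(* The constant 15 makes 3 eta / eps equal to eps / 5, so s^3 <= eps^2 / 125, just below eta / 8 =
   eps^2 / 120. The errors are then at most 1/4 and 1/25 of [eta ^+ 2], against a gain of 3/4. *)
have se : s < eps / 5 by rewrite /eta in h; nra.
have ee : eta <= 1 / 15 by rewrite /eta; nra.
have i1 : w ^+ 2 <= 1 / 4.
  have : w <= 1 / 2 by rewrite /w; lra.
  by nra.
have i2 : eta ^+ 2 * s ^+ 2 <= eta ^+ 2 * (1 / 25).
  by rewrite ler_wpM2l ?sqr_ge0//; nra.
have i3 : 2 * eta * s ^+ 3 <= 1 / 4 * eta ^+ 2.
  have -> : 1 / 4 * eta ^+ 2 = 2 * eta * (eps ^+ 2 / 120) by rewrite /eta; field.
  apply: ler_wpM2l; first by rewrite mulr_ge0// ltW.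
  have s2 : s ^+ 2 <= (eps / 5) ^+ 2 by rewrite lerXn2r ?nnegrE ?divr_ge0// ltW.
  have -> : s ^+ 3 = s ^+ 2 * s by ring.
  have : s ^+ 2 * s <= (eps / 5) ^+ 2 * (1 / 5).
    by apply: ler_pM => //; rewrite ?sqr_ge0//; lra.
  move=> h2; apply: (le_trans h2).
  have := sqr_ge0 eps; lra.
have i4 : (3 / 4) * eta ^+ 2 <= (1 - w ^+ 2) * eta ^+ 2.
  by rewrite ler_wpM2r ?sqr_ge0//; lra.
have i5 : 0 <= eps * s ^+ 4 by rewrite mulr_ge0 ?exprn_ge0// ltW.
have := sqr_ge0 eta; lra.
Qed.

(** The first Dirichlet eigenfunction sin (pi (x - al) / l), lowered by eta and composed with E(s) =
    s exp(-eta/s). The closed set [S] inside the open interval is returned with it, so that products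
    of two profiles have compact support in an open rectangle. *)
Lemma profile_exists (eps al l : R) : 0 < eps -> eps <= 1 -> 0 < l ->
  exists f f1 f2 (S : set R), [/\ forall k, C1k k f,
    forall x : R, is_derive x (1 : R) f (f1 x),
    forall x : R, is_derive x (1 : R) f1 (f2 x),
    closed S /\ (forall x, S x -> al < x < al + l) &
    [/\ forall x, ~ S x -> f x = 0, forall x, 0 <= f x,
      f (al + l / 2) > 0 &
      forall x, - f2 x <= (1 + eps) * (pi / l) ^+ 2 * f x]].
Proof.
move=> e0 e1 l0; pose eta := eps ^+ 2 / 15.
have eta0 : 0 < eta by rewrite divr_gt0// exprn_gt0.
have eta1 : eta < 1 by rewrite /eta; nra.
pose ka := pi / l.
have ka0 : 0 < ka by rewrite divr_gt0// pi_gt0.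
have kl : ka * l = pi by rewrite divfK// gt_eqF.
pose w x := sin (ka * (x - al)); pose v x := cos (ka * (x - al)).
(* With s = w - eta: E is s [T 0], E' is [T 0] + eta [T 1] and E'' is eta^2 [T 3]. Hence [g1] and
   [g2] are the chain rule for E(w - eta). *)
pose T n x := flat eta n (w x - eta).
pose g x := (w x - eta) * T 0%N x.
pose g1 x := (T 0%N x + eta * T 1%N x) * (v x * ka).
pose g2 x := eta ^+ 2 * T 3%N x * (v x * ka) ^+ 2 -
  (T 0%N x + eta * T 1%N x) * (w x * ka ^+ 2).
have dlin (t : R) : is_derive t (1:R) (fun t => ka * (t - al)) ka.
  exact: is_derive1_affine.
have dw (t : R) : is_derive t (1:R) w (v t * ka).
  by apply: is_derive1_comp; exact: dlin.
have dv (t : R) : is_derive t (1:R) v (- w t * ka).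
  by apply: is_derive1_comp; exact: dlin.
have dwe (t : R) : is_derive t (1:R) (fun x => w x - eta) (v t * ka).
  apply: (is_derive_eq (is_derive1_add (dw t) (is_derive_cst (- eta) t (1:R)))).
  by rewrite addr0.
have dT n (t : R) : is_derive t (1:R) (T n)
    ((- n%:R * T n.+1 t + eta * T n.+2 t) * (v t * ka)).
  by apply: is_derive1_comp (dwe t); exact: is_derive1_flat.
have sT (t : R) n : (w t - eta) * T n.+1 t = T n t.
  rewrite /T /flat; case: ifP => h; last by rewrite mulr0.
  by rewrite exprS invfM !mulrA divff ?mul1r// gt_eqF.
have dg (t : R) : is_derive t (1:R) g (g1 t).
  apply: (is_derive_eq (is_derive1_mul (dwe t) (dT 0%N t))).
  by rewrite /g1 -[T 1%N t](sT t 1%N); ring.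
have dg1 (t : R) : is_derive t (1:R) g1 (g2 t).
  apply: (is_derive_eq (is_derive1_mul (is_derive1_add (dT 0%N t)
    (is_derive1_mul (is_derive_cst eta t (1:R)) (dT 1%N t)))
    (is_derive1_mul (dv t) (is_derive_cst ka t (1:R))))).
  by rewrite /g2 /cst; ring.
have cw : continuous w by move=> t; exact: is_derive1_continuous (dw t).
(* The sine is 0 < eta at both ends of the interval, so [U] is an open set around the two cut points
   on which [g] vanishes. *)
pose U := w @^-1` [set x | x < eta].
have oU : open U by move/continuousP: cw; apply; exact: open_lt.
have Ua : U al by rewrite /U/= /w subrr mulr0 sin0.
have Ub : U (al + l) by rewrite /U/= /w addrAC subrr add0r kl sinpi.
have T0 n x : U x -> T n x = 0.
  by rewrite /U/= => ux; rewrite /T /flat subr_gt0 ltNge (ltW ux).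
have g0 x : U x -> g x = 0 by move=> /(T0 0%N) h; rewrite /g h mulr0.
have g10 x : U x -> g1 x = 0.
  by move=> ux; rewrite /g1 !T0// mulr0 addr0 mul0r.
pose b := al + l.
exists (restr al b g), (restr al b g1), (restr al b g2).
exists ([set x | eta <= w x] `&` `[al, b]); split.
- move=> k; apply: C1k_restr oU Ua Ub g0 _.
  have c1 : C1k k.+1 (fun x => w x - eta).
    apply: C1k_add; last exact: C1k_cst.
    have := C1k_comp (C1k_affine k.+1 ka al) (C1k_sin_cos k.+1 1).1.
    by under eq_fun do rewrite mul1r.
  apply: C1k_mul => //; exact: (C1k_comp c1 (C1k_flat k.+1 0 eta0)).
- exact: is_derive1_restr oU Ua Ub g0 dg.
- exact: is_derive1_restr oU Ua Ub g10 dg1.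
- split.
    apply: closedI; last exact: interval_closed.
    have -> : [set x | eta <= w x] = w @^-1` [set x | eta <= x] by [].
    by apply: (continuous_closedP w).1 => //; exact: closed_ge.
  move=> x [/= wx]; rewrite in_itv/= => /andP[]; rewrite !le_eqVlt.
  have nU : ~ U x by move=> Ux; have := le_lt_trans wx Ux; rewrite ltxx.
  move=> /predU1P[ex|ax]; first by exfalso; apply: nU; rewrite -ex.
  move=> /predU1P[ex|xb]; first by exfalso; apply: nU; rewrite ex.
  by rewrite ax.
have Tpos n x : 0 <= T n x.
  rewrite /T /flat; case: ifP => // h.
  by rewrite mulr_ge0 ?expR_ge0// invr_ge0 exprn_ge0// ltW.
have gpos x : 0 <= g x.
  rewrite /g; have [h|h] := leP 0 (w x - eta); first by rewrite mulr_ge0.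
  by rewrite T0 ?mulr0// /U/=; lra.
split.
- move=> x nS; rewrite /restr; case: ifP => // /andP[ax xb].
  apply: g0; rewrite /U/= ltNge; apply/negP => h; apply: nS; split => //.
  by rewrite /= in_itv/= !ltW.
- by move=> x; rewrite /restr; case: ifP.
- have lb : al < al + l / 2 < b by rewrite /b; apply/andP; split; lra.
  rewrite /restr lb /g /T /flat.
  have -> : w (al + l / 2) = 1.
    by rewrite /w addrAC subrr add0r mulrA kl sin_pihalf.
  by rewrite subr_gt0 eta1 expr0 invr1 mul1r mulr_gt0 ?subr_gt0 ?expR_gt0.
move=> x; rewrite /restr; case: ifP => [_|_]; last by rewrite oppr0 mulr0.
rewrite -/ka.
have [h|h] := leP (w x) eta.
  have z n : T n x = 0 by rewrite /T /flat subr_gt0 ltNge h.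
  by rewrite /g2 /g !z !(mulr0, mul0r, addr0, oppr0).
have s0 : 0 < w x - eta by rewrite subr_gt0.
set s := w x - eta in s0.
have ws : w x = s + eta by rewrite /s subrK.
have w1 : s + eta <= 1 by rewrite -ws /w sin_le1.
have := profile_ineq e0 e1 s0 w1; rewrite -/eta => ineq.
pose X := T 0%N x.
have TS n : T n.+1 x = T n x / s.
  by rewrite -(sT x n) -/s mulrAC divff ?mul1r// gt_eqF.
have T1 : T 1%N x = X / s by rewrite TS.
have T3 : T 3%N x = X / s ^+ 3.
  by rewrite !TS -/X; field; rewrite gt_eqF.
have v2 : v x ^+ 2 = 1 - (s + eta) ^+ 2.
  by have := cos2Dsin2 (ka * (x - al)); rewrite -/(w x) -/(v x) -ws => <-; ring.
have vk : (v x * ka) ^+ 2 = (1 - (s + eta) ^+ 2) * ka ^+ 2 by rewrite -v2; ring.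
have -> : - g2 x = ka ^+ 2 * X * ((s + eta) * (1 + eta / s) -
    (1 - (s + eta) ^+ 2) * (eta ^+ 2 / s ^+ 3)).
  by rewrite /g2 T1 T3 -/X vk ws; field; rewrite gt_eqF.
rewrite /g -/s -/X.
have -> : (1 + eps) * ka ^+ 2 * (s * X) = ka ^+ 2 * X * ((1 + eps) * s) by ring.
by rewrite ler_wpM2l// mulr_ge0 ?sqr_ge0//; exact: Tpos.
Qed.
End Profile.

(** * Products of profiles and the upper bound for the first eigenvalue *)

Section Product.
Context {R : realType}.
Implicit Types (p q : R -> R) (W : set (borel_plane R)).

Definition tensor p q (z : R * R) : R := p z.1 * q z.2.

Lemma continuous_tensor p q : continuous p -> continuous q ->
  continuous (tensor p q).
Proof.
move=> cp cq z; apply: cvgM.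
  by apply: (@continuous_comp _ _ _ fst p); [exact: cvg_fst|exact: cp].
by apply: (@continuous_comp _ _ _ snd q); [exact: cvg_snd|exact: cq].
Qed.

Lemma is_derive_tensor1 p p' q (z : R * R) :
  is_derive z.1 (1 : R) p (p' z.1) ->
  is_derive z (1, 0) (tensor p q) (tensor p' q z).
Proof.
case: z => x y dp.
have := is_derive1_mul dp (is_derive_cst (q y) x (1 : R)).
rewrite mulr0 addr0 /= => -[d e].
have E : (fun h : R => h^-1 *: ((tensor p q \o shift (x, y)) (h *: (1, 0)) - tensor p q (x, y)))
  = (fun h : R => h^-1 *: (((fun t => p t * cst (q y) t) \o shift x) (h *: 1) -
    p x * q y)).
  apply/funext => h /=; congr (_ *: (_ - _)).
  by rewrite /tensor /= scaler0 add0r.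
apply: DeriveDef; first by rewrite /derivable E; exact: d.
by rewrite /derive E; exact: e.
Qed.

Lemma is_derive_tensor2 p q q' (z : R * R) :
  is_derive z.2 (1 : R) q (q' z.2) ->
  is_derive z (0, 1) (tensor p q) (tensor p q' z).
Proof.
case: z => x y dq.
have := is_derive1_mul (is_derive_cst (p x) y (1 : R)) dq.
rewrite mul0r add0r /= => -[d e].
have E : (fun h : R => h^-1 *: ((tensor p q \o shift (x, y)) (h *: (0, 1)) - tensor p q (x, y)))
  = (fun h : R => h^-1 *: (((fun t => cst (p x) t * q t) \o shift y) (h *: 1) -
    p x * q y)).
  apply/funext => h /=; congr (_ *: (_ - _)).
  by rewrite /tensor /= scaler0 add0r.
apply: DeriveDef; first by rewrite /derivable E; exact: d.
by rewrite /derive E; exact: e.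
Qed.

Lemma d1_tensor p p' q : (forall x : R, is_derive x (1 : R) p (p' x)) ->
  d1 (tensor p q) = tensor p' q.
Proof.
by move=> dp; apply/funext => z; have [] := is_derive_tensor1 q (dp z.1).
Qed.

Lemma d2_tensor p q q' : (forall x : R, is_derive x (1 : R) q (q' x)) ->
  d2 (tensor p q) = tensor p q'.
Proof.
by move=> dq; apply/funext => z; have [] := is_derive_tensor2 p (dq z.2).
Qed.

Lemma Ck_tensor k p q : C1k k p -> C1k k q -> Ck k (tensor p q).
Proof.
elim: k p q => [|k IH] p q cp cq.
  by split => //; apply: continuous_tensor.
split.
  by apply: continuous_tensor; [exact: C1k_continuous cp|exact: C1k_continuous cq].
have cp' := C1k_pred cp; have cq' := C1k_pred cq.
move: cp cq => [p' dp cp] [q' dq cq]; split.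
- by move=> z; have [] := is_derive_tensor1 q (dp z.1).
- by move=> z; have [] := is_derive_tensor2 p (dq z.2).
- by rewrite (d1_tensor q dp); exact: IH.
- by rewrite (d2_tensor p dq); exact: IH.
Qed.

Lemma test_function_tensor W p q (S T : set R) (a b c d : R) :
  (forall k, C1k k p) -> (forall k, C1k k q) ->
  closed S -> closed T -> (forall x, ~ S x -> p x = 0) ->
  (forall x, ~ T x -> q x = 0) -> S `<=` `[a, b] -> T `<=` `[c, d] ->
  S `*` T `<=` W -> test_function W (tensor p q).
Proof.
move=> sp sq cS cT p0 q0 Sab Tcd STW.
have cST : closed (S `*` T : set (R * R)).
  have -> : S `*` T = (fst @^-1` S) `&` (snd @^-1` T) by [].
  apply: closedI.
    by apply: (continuous_closedP fst).1 => // z; exact: cvg_fst.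
  by apply: (continuous_closedP snd).1 => // z; exact: cvg_snd.
have sub : closure [set x | tensor p q x != 0] `<=` S `*` T.
  rewrite [X in _ `<=` X](closure_id _).1//.
  apply: closure_subset => z /= z0; split; apply: contrapT => h; move/eqP: z0; apply.
    by rewrite /tensor p0 ?mul0r.
  by rewrite /tensor q0 ?mulr0.
split.
- by move=> k; exact: Ck_tensor.
- apply: (@subclosed_compact _ _ (`[a, b] `*` `[c, d])).
  + exact: closed_closure.
  + by apply: compact_setX; exact: segment_compact.
  + by move=> z /sub [/Sab ? /Tcd ?].
- exact: subset_trans sub STW.
Qed.

(** By continuity [phi] is positive on a small closed square, which lies in [W] and has positive
    measure, so it fits in no null set. *)
Lemma not_ae_eq0 W (phi : R * R -> R) z0 : continuous phi -> 0 < phi z0 ->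
  (forall z, ~ W z -> phi z = 0) ->
  ~ {ae leb2 R, forall z, W z -> phi z = 0}.
Proof.
move=> cp pz0 p0 [N [mN N0 sub]].
have oU : open (phi @^-1` [set x | 0 < x]).
  by move/continuousP: cp; apply; exact: open_gt.
have /nbhs_ballP[e /= e0 be] := open_nbhs_nbhs (conj oU pz0 : open_nbhs z0 _).
have [r r0 re] : exists2 r, 0 < r & r < e by exists (e / 2); lra.
pose B : set (R * R) := `[z0.1 - r, z0.1 + r] `*` `[z0.2 - r, z0.2 + r].
have BN : B `<=` N.
  move=> z [/=]; rewrite !in_itv/= => /andP[? ?] /andP[? ?].
  have pz : 0 < phi z.
    by apply: be; split; rewrite /ball/= ltr_norml; apply/andP; split; lra.
  have Wz : W z by apply: contrapT => /p0 pz0'; move: pz; rewrite pz0' ltxx.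
  by apply: sub => /= /(_ Wz) pz0'; move: pz; rewrite pz0' ltxx.
have mB : measurable (B : set (borel_plane R)).
  by apply: measurableX; exact: measurable_itv.
have : (leb2 R B <= leb2 R N)%E by apply: le_measure; rewrite ?inE.
rewrite N0 leb2_rect; [|by lra|by lra].
by rewrite lee_fin leNgt mulr_gt0//; lra.
Qed.

(** The test function is the product of a profile in each direction. As both factors are
    nonnegative, the two one-dimensional inequalities can be multiplied by the other factor and
    added. *)
Lemma eigenvalue_le_rect W (lambda eps x0 y0 l h : R) u : measurable W ->
  dirichlet_eigenfunction W lambda u ->
  {ae leb2 R, forall x, W x -> 0 < u x} ->
  0 < eps -> eps <= 1 -> 0 < l -> 0 < h ->
  (forall x y, x0 < x < x0 + l -> y0 < y < y0 + h -> W (x, y)) ->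
  lambda <= (1 + eps) * ((pi / l) ^+ 2 + (pi / h) ^+ 2).
Proof.
move=> mW eu upos e0 e1 l0 h0 sub.
have [p [p1 [p2 [S [sp dp dp1 [cS Ss] [pS p0 pm pl]]]]]] := profile_exists x0 e0 e1 l0.
have [q [q1 [q2 [T [sq dq dq1 [cT Ts] [qT q0 qm ql]]]]]] := profile_exists y0 e0 e1 h0.
have tpq : test_function W (tensor p q).
  apply: (test_function_tensor sp sq cS cT pS qT
    (a := x0) (b := x0 + l) (c := y0) (d := y0 + h)).
  - by move=> x /Ss; rewrite /= in_itv/= => /andP[? ?]; rewrite !ltW.
  - by move=> x /Ts; rewrite /= in_itv/= => /andP[? ?]; rewrite !ltW.
  - by move=> [x y] [/= /Ss xS /Ts yT]; exact: sub.
apply: (eigenvalue_le mW eu upos tpq).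
- by move=> z; rewrite mulr_ge0.
- apply: (@not_ae_eq0 _ _ (x0 + l / 2, y0 + h / 2)).
  + exact: test_function_continuous tpq.
  + by rewrite /tensor mulr_gt0.
  + by move=> z; exact: test_function_eq0.
move=> z; rewrite (d1_tensor q dp) (d1_tensor q dp1) (d2_tensor p dq) (d2_tensor p dq1).
rewrite /tensor.
have h1 : - p2 z.1 * q z.2 <= (1 + eps) * (pi / l) ^+ 2 * p z.1 * q z.2.
  by rewrite ler_wpM2r.
have h2 : p z.1 * - q2 z.2 <= p z.1 * ((1 + eps) * (pi / h) ^+ 2 * q z.2).
  by rewrite ler_wpM2l.
lra.
Qed.
End Product.

(** * The quadrilateral *)

Section Hull.
Context {R : realType}.
Implicit Types (A : set (R * R)).

Lemma convex_hull_conv A (p q : R * R) (t : R) : 0 <= t -> t <= 1 ->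
  convex_hull A p -> convex_hull A q ->
  convex_hull A (t * p.1 + (1 - t) * q.1, t * p.2 + (1 - t) * q.2).
Proof.
move=> t0 t1 hp hq B [cB AB].
have := cB p q (Itv01 t0 t1).
rewrite !inE => /(_ (hp _ (conj cB AB)) (hq _ (conj cB AB))).
by [].
Qed.

Lemma convex_hull_halfplane A (al be ga : R) :
  (forall z, A z -> al * z.1 + be * z.2 <= ga) ->
  forall z, convex_hull A z -> al * z.1 + be * z.2 <= ga.
Proof.
move=> Ah z; apply: (smallest_sub (X := [set z | al * z.1 + be * z.2 <= ga])) => //.
move=> p q t; rewrite !inE /= => hp hq.
have t0 : 0 <= t%:num by [].
have t1 : t%:num <= 1 by [].
move: (t%:num) t0 t1 => s s0 s1.
have -> : al * (s * p.1 + (1 - s) * q.1) + be * (s * p.2 + (1 - s) * q.2) =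
  s * (al * p.1 + be * p.2) + (1 - s) * (al * q.1 + be * q.2) by ring.
have h1 : s * (al * p.1 + be * p.2) <= s * ga by rewrite ler_wpM2l.
have h2 : (1 - s) * (al * q.1 + be * q.2) <= (1 - s) * ga.
  by rewrite ler_wpM2l// subr_ge0.
lra.
Qed.

Variables (N a b : R).
Hypothesis Nab : [/\ 0 < N, 0 <= a, a <= 1, 0 <= b & b <= N].

Local Notation V := ([set (0, a); (0, -1 + a); (b, 0); (- N + b, 0)] : set (R * R)).
Local Notation Q := (open_quadrilateral (0, a) (0, -1 + a) (b, 0) (- N + b, 0)).

Lemma open_quadrilateral_open : open Q.
Proof. exact: open_interior. Qed.

(** A half-plane containing the four vertices contains their hull; each outer bound below is an
    instance with a suitable line. *)
Lemma open_quadrilateral_halfplane (al be ga : R) :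
  be * a <= ga -> be * (-1 + a) <= ga -> al * b <= ga -> al * (- N + b) <= ga ->
  forall z, Q z -> al * z.1 + be * z.2 <= ga.
Proof.
have [N0 a0 a1 b0 bN] := Nab.
move=> h1 h2 h3 h4 z /interior_subset; apply: convex_hull_halfplane.
move=> y [[[]|]|] ->/=; lra.
Qed.

Lemma open_quadrilateral_bounds z : Q z ->
  [/\ - N + b <= z.1, z.1 <= b, -1 + a <= z.2 & z.2 <= a].
Proof.
have [N0 a0 a1 b0 bN] := Nab.
move=> Qz; split.
- have : (-1) * z.1 + 0 * z.2 <= (N - b).
    by apply: open_quadrilateral_halfplane Qz; nra.
  lra.
- have : 1 * z.1 + 0 * z.2 <= b.
    by apply: open_quadrilateral_halfplane Qz; nra.
  lra.
- have : 0 * z.1 + (-1) * z.2 <= (1 - a).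
    by apply: open_quadrilateral_halfplane Qz; nra.
  lra.
- have : 0 * z.1 + 1 * z.2 <= a.
    by apply: open_quadrilateral_halfplane Qz; nra.
  lra.
Qed.

(** These are the half-planes bounded by the lines through [(b, 0)] and the two vertices on the
    vertical axis. Without division by [b] they remain meaningful for [b = 0]. *)
Lemma open_quadrilateral_right z : Q z ->
  (-1 + a) * (b - z.1) <= b * z.2 /\ b * z.2 <= a * (b - z.1).
Proof.
have [N0 a0 a1 b0 bN] := Nab.
move=> Qz; split.
- have : (1 - a) * z.1 + (- b) * z.2 <= ((1 - a) * b).
    by apply: open_quadrilateral_halfplane Qz; nra.
  nra.
- have : a * z.1 + b * z.2 <= (a * b).
    by apply: open_quadrilateral_halfplane Qz; nra.
  nra.
Qed.

Lemma open_quadrilateral_left z : Q z ->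
  (-1 + a) * (N - b + z.1) <= (N - b) * z.2 /\
  (N - b) * z.2 <= a * (N - b + z.1).
Proof.
have [N0 a0 a1 b0 bN] := Nab.
move=> Qz; split.
- have : (- (1 - a)) * z.1 + (- (N - b)) * z.2 <= ((1 - a) * (N - b)).
    by apply: open_quadrilateral_halfplane Qz; nra.
  nra.
- have : (- a) * z.1 + (N - b) * z.2 <= (a * (N - b)).
    by apply: open_quadrilateral_halfplane Qz; nra.
  nra.
Qed.

(** With t = |x|/N, this minorises the slice eigenvalue pi^2 / (1 - t)^2, because (1 + 2t)(1 - t)^2
    <= 1. Being affine in |x|, it yields a bound on a first moment. *)
Definition quad_weight (x : R) : R := pi ^+ 2 * (1 + 2 * `|x| / N).

Lemma quad_weight_slice (x l : R) : 0 <= l -> l <= 1 - `|x| / N ->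
  quad_weight x * l ^+ 2 <= pi ^+ 2.
Proof.
have [N0 a0 a1 b0 bN] := Nab.
move=> l0 l1; rewrite /quad_weight -mulrA -[leRHS]mulr1.
apply: ler_wpM2l; first exact: sqr_ge0.
rewrite -mulrA; have t0 : 0 <= `|x| / N by rewrite divr_ge0// ltW.
move: (_ / _) t0 l1 => t t0 l1.
have : l ^+ 2 <= (1 - t) ^+ 2 by rewrite lerXn2r// nnegrE//; lra.
have t1 : t <= 1 by lra.
move=> h; apply: (@le_trans _ _ ((1 + 2 * t) * (1 - t) ^+ 2)).
  by rewrite ler_wpM2l//; lra.
have -> : (1 + 2 * t) * (1 - t) ^+ 2 = 1 - t ^+ 2 * (3 - 2 * t) by ring.
by rewrite gerBl mulr_ge0 ?sqr_ge0//; lra.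
Qed.

(** The slice at x >= 0 has length at most 1 - x/b, and b <= N turns this into 1 - x/N; the left
    half is the same with N - b. *)
Lemma open_quadrilateral_slices : slices_bounded Q quad_weight.
Proof.
have [N0 a0 a1 b0 bN] := Nab.
move=> x; have [[y0 Qy0]|nQ] := pselect (exists y, Q (x, y)); last first.
  exists 0, 0; split => //; first by rewrite expr0n mulr0 sqr_ge0.
  by move=> y Qy; exfalso; apply: nQ; exists y.
have [/= xl xr _ _] := open_quadrilateral_bounds Qy0.
have [x0|x0] := leP 0 x.
(* If [b = 0] there is no right half: only x = 0 remains, where an interval of length 1 is
   enough. *)
- have [b00|b00] := eqVneq b 0.
    have xe : x = 0 by apply/eqP; rewrite eq_le x0 andbT -b00.
    exists (-1 + a), 1; split => //.
      by apply: quad_weight_slice => //; rewrite xe normr0 mul0r subr0.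
    by move=> y /open_quadrilateral_bounds[/= _ _ h1 h2]; apply/andP; split; lra.
  have bp : 0 < b by rewrite lt_neqAle eq_sym b00.
  have xb : x / b <= 1 by rewrite ler_pdivrMr// mul1r.
  exists ((-1 + a) * (1 - x / b)), (1 - x / b); split.
  + by rewrite subr_ge0.
  + apply: quad_weight_slice; first by rewrite subr_ge0.
    by rewrite ger0_norm// lerB// ler_wpM2l// lef_pV2.
  + move=> y /open_quadrilateral_right[/= h1 h2].
    have e : b * (1 - x / b) = b - x by rewrite mulrBr mulr1 mulrC divfK.
    by apply/andP; split; rewrite -(ler_pM2l bp); nra.
- have bp : 0 < N - b by lra.
  have xb : - x / (N - b) <= 1 by rewrite ler_pdivrMr// mul1r; lra.
  exists ((-1 + a) * (1 - - x / (N - b))), (1 - - x / (N - b)); split.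
  + by rewrite subr_ge0.
  + apply: quad_weight_slice; first by rewrite subr_ge0.
    rewrite ltr0_norm// lerB// ler_wpM2l ?lef_pV2//; try by rewrite ?posrE; lra.
  + move=> y /open_quadrilateral_left[/= h1 h2].
    have e : (N - b) * (1 - - x / (N - b)) = N - b + x.
      by field; rewrite gt_eqF.
    by apply/andP; split; rewrite -(ler_pM2l bp); nra.
Qed.

(** The point is a mixture, with weights s and 1 - s, of the tip [(c, 0)] and a point of the segment
    between the two vertices on the vertical axis. *)
Lemma convex_hull_quadrilateral (x y c s : R) :
  c = b \/ c = - N + b -> 0 <= s -> s <= 1 -> x = s * c ->
  (-1 + a) * (1 - s) <= y -> y <= a * (1 - s) ->
  convex_hull [set (0, a); (0, -1 + a); (b, 0); (- N + b, 0)] (x, y).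
Proof.
have [N0 a0 a1 b0 bN] := Nab.
move=> hc s0 s1 -> y1 y2.
have hC : convex_hull V (c, 0).
  apply: sub_gen_smallest; case: hc => ->; rewrite /V /=.
    by left; right.
  by right.
have hA : convex_hull V (0, a) by apply: sub_gen_smallest; left; left; left.
have hB : convex_hull V (0, -1 + a) by apply: sub_gen_smallest; left; left; right.
have [es|ns] := eqVneq s 1.
  have -> : y = 0 by rewrite es subrr !mulr0 in y1 y2; apply/eqP; rewrite eq_le y2 y1.
  by rewrite es mul1r.
have s2 : 0 < 1 - s by rewrite subr_gt0 lt_neqAle ns.
(* The point of the vertical segment with parameter t has height t a + (1 - t)(-1 + a) = t - 1 + a,
   which has to equal y / (1 - s). *)
pose t := y / (1 - s) + 1 - a.
have yt : y = (1 - s) * (t - 1 + a) by rewrite /t; field; rewrite gt_eqF.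
have t0 : 0 <= t by nra.
have t1 : t <= 1 by nra.
have := convex_hull_conv s0 s1 hC (convex_hull_conv t0 t1 hA hB).
rewrite /= !(mulr0, add0r, addr0) => h.
suff -> : y = (1 - s) * (t * a + (1 - t) * (-1 + a)) by [].
by rewrite yt; ring.
Qed.

(** The rectangle is placed against the vertical axis on the longer side. That side has length at
    least N/2, so at distance at most L from the axis the slice has shrunk by a proportion of at
    most 2L/N. *)
Lemma open_quadrilateral_rect (L : R) : 0 < L -> 2 * L < N ->
  exists x0, forall x y, x0 < x < x0 + L ->
    (-1 + a) * (1 - 2 * L / N) < y <
      (-1 + a) * (1 - 2 * L / N) + (1 - 2 * L / N) ->
    Q (x, y).
Proof.
have [N0 a0 a1 b0 bN] := Nab.
move=> L0 LN; pose r := 1 - 2 * L / N.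
have r0 : 0 < r by rewrite subr_gt0 ltr_pdivrMr// mul1r.
(* An open rectangle contained in the hull lies in its interior, so membership in the hull is all
   that has to be checked. *)
have key x0 : (forall x y, x0 < x < x0 + L -> (-1 + a) * r < y < a * r ->
      convex_hull [set (0, a); (0, -1 + a); (b, 0); (- N + b, 0)] (x, y)) ->
    exists x0, forall x y, x0 < x < x0 + L ->
      (-1 + a) * r < y < (-1 + a) * r + r -> Q (x, y).
  move=> h; exists x0 => x y xx yy.
  have oS : open (`]x0, x0 + L[ `*` `](-1 + a) * r, (-1 + a) * r + r[ : set (R * R)).
    have -> : `]x0, x0 + L[ `*` `](-1 + a) * r, (-1 + a) * r + r[ =
      (fst @^-1` `]x0, x0 + L[) `&` (snd @^-1` `](-1 + a) * r, (-1 + a) * r + r[)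
      :> set (R * R) by [].
    apply: openI.
      by apply: (continuousP fst).1 => [z|]; [exact: cvg_fst|exact: interval_open].
    by apply: (continuousP snd).1 => [z|]; [exact: cvg_snd|exact: interval_open].
  have : nbhs (x, y) (`]x0, x0 + L[ `*` `](-1 + a) * r, (-1 + a) * r + r[ : set (R * R)).
    by apply: open_nbhs_nbhs; split => //; split; rewrite /= in_itv.
  apply: filterS => -[x' y'] [/=]; rewrite !in_itv/= => hx hy.
  apply: h => //; move: hy; have -> : (-1 + a) * r + r = a * r by ring.
  by [].
have yb y s : s <= 2 * L / N -> (-1 + a) * r < y < a * r ->
    (-1 + a) * (1 - s) <= y /\ y <= a * (1 - s).
  move=> sL /andP[y1 y2]; have rs : r <= 1 - s by rewrite /r lerB.
  by split; nra.
have [hb|hb] := leP N (2 * b).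
- have bp : 0 < b by lra.
  apply: (key 0) => x y; rewrite add0r => /andP[x0 xL] yy.
  have s1 : x / b <= 2 * L / N.
    rewrite ler_pdivrMr// mulrAC ler_pdivlMr//; nra.
  have s2 : 2 * L / N < 1 by rewrite ltr_pdivrMr// mul1r.
  have [y1 y2] := yb y (x / b) s1 yy.
  apply: (convex_hull_quadrilateral (c := b) (s := x / b)) => //.
  + by left.
  + by rewrite divr_ge0// ltW.
  + by rewrite (le_trans s1)// ltW.
  + by rewrite divfK// gt_eqF.
- have bp : 0 < N - b by lra.
  apply: (key (- L)) => x y; rewrite addNr => /andP[x0 xL] yy.
  have s1 : - x / (N - b) <= 2 * L / N.
    rewrite ler_pdivrMr// mulrAC ler_pdivlMr//; nra.
  have s2 : 2 * L / N < 1 by rewrite ltr_pdivrMr// mul1r.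
  have [y1 y2] := yb y (- x / (N - b)) s1 yy.
  apply: (convex_hull_quadrilateral (c := - N + b) (s := - x / (N - b))) => //.
  + by right.
  + by rewrite divr_ge0//; lra.
  + by rewrite (le_trans s1)// ltW.
  + by field; rewrite gt_eqF.
Qed.

Lemma open_quadrilateral_measurable : measurable (Q : set (borel_plane R)).
Proof. by apply: open_plane_measurable; exact: open_quadrilateral_open. Qed.

(** Only the order N matters (the exact area is N/2). The lower bound uses a closed N/8 by 1/4
    rectangle inside the open one obtained with L = N/4, the upper bound the box of sides 2N and
    2. *)
Lemma open_quadrilateral_area :
  ((N / 32)%:E <= leb2 R Q)%E /\ (leb2 R Q <= (4 * N)%:E)%E.
Proof.
have [N0 a0 a1 b0 bN] := Nab.
have mQ := open_quadrilateral_measurable.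
split.
  have [||x0 h] := @open_quadrilateral_rect (N / 4); [by lra|by lra|].
  have r2 : 1 - 2 * (N / 4) / N = 1 / 2 by field; rewrite gt_eqF.
  rewrite r2 in h.
  pose y0 := (-1 + a) * (1 / 2).
  pose B : set (R * R) := `[x0 + N / 16, x0 + N / 16 + N / 8] `*` `[y0 + 1 / 8, y0 + 1 / 8 + 1 / 4].
  have mB : measurable (B : set (borel_plane R)).
    by apply: measurableX; exact: measurable_itv.
  have BQ : B `<=` Q.
    move=> [x y] [/=]; rewrite !in_itv/= => /andP[? ?] /andP[? ?].
    by apply: h; apply/andP; split; rewrite -/y0; lra.
  have : (leb2 R B <= leb2 R Q)%E by apply: le_measure; rewrite ?inE.
  apply: le_trans; rewrite leb2_rect; [|by lra|by lra].
  by rewrite lee_fin; lra.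
pose B : set (R * R) := `[- N, N] `*` `[-1, 1].
have mB : measurable (B : set (borel_plane R)).
  by apply: measurableX; exact: measurable_itv.
have QB : Q `<=` B.
  move=> [x y] /open_quadrilateral_bounds[/= ? ? ? ?].
  by split; rewrite /= in_itv/=; apply/andP; split; lra.
have : (leb2 R Q <= leb2 R B)%E by apply: le_measure; rewrite ?inE.
move=> /le_trans; apply; rewrite leb2_rect; [|by lra|by lra].
by rewrite lee_fin; lra.
Qed.
End Hull.

(** * Integral of the weight *)

Section Log.
Context {R : realType}.
Notation mu := (@lebesgue_measure R).

(** [c] is a sign: with c = 1 or c = -1, the expression c x stands for |x| on the corresponding
    half-line. *)
Lemma is_derive_log (c m t : R) : 0 < m -> c ^+ 2 = 1 -> 0 < 1 + c * t / m ->
  is_derive t (1 : R) (fun x => c * m * ln (1 + c * x / m)) (1 + c * t / m)^-1.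
Proof.
move=> m0 c1 pos.
have dl : is_derive t (1 : R) (fun x => 1 + c * x / m) (c / m).
  apply: (is_derive_eq (is_derive1_add (is_derive_cst (1 : R) t (1 : R))
    (is_derive1_mul (is_derive1_mul (is_derive_cst c t (1 : R)) (is_derive_id t 1))
      (is_derive_cst m^-1 t (1 : R))))).
  by rewrite /cst/=; ring.
have D := is_derive1_mul (is_derive_cst (c * m) t (1 : R))
  (@is_derive1_comp R (@ln R) (fun x => 1 + c * x / m) t _ _ (is_derive1_ln pos) dl).
apply: (is_derive_eq D).
rewrite mul0r add0r /cst.
have -> : c * m * ((1 + c * t / m)^-1 * (c / m)) = c ^+ 2 * (m / m) * (1 + c * t / m)^-1.
  by ring.
by rewrite c1 divff ?mul1r// gt_eqF.
Qed.

Lemma integral_log (c m p q : R) : 0 < m -> c ^+ 2 = 1 -> p < q ->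
  {in `[p, q], forall t, 0 < 1 + c * t / m} ->
  (\int[mu]_(t in `[p, q]) ((1 + c * t / m)^-1)%:E =
   (c * m * ln (1 + c * q / m))%:E - (c * m * ln (1 + c * p / m))%:E)%E.
Proof.
move=> m0 c1 pq pos.
have cl (t : R) : {for t, continuous (fun t => 1 + c * t / m)}.
  apply: cvgD; first exact: cvg_cst.
  apply: cvgM; last exact: cvg_cst.
  by apply: cvgM; [exact: cvg_cst|exact: cvg_id].
have ci t : t \in `[p, q] -> {for t, continuous (fun t => (1 + c * t / m)^-1)}.
  by move=> /pos h; apply: cvgV; [rewrite gt_eqF|exact: cl].
have dG t : t \in `[p, q] -> is_derive t (1 : R) (fun x => c * m * ln (1 + c * x / m)) (1 + c * t / m)^-1.
  by move=> /pos; exact: is_derive_log.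
apply: (@continuous_FTC2 _ _ (fun x => c * m * ln (1 + c * x / m))) => //.
- by apply: continuous_in_subspaceT => x; rewrite inE; exact: ci.
- split.
  + by move=> x xab; have [] := dG x (subset_itv_oo_cc xab).
  + apply: cvg_at_right_filter; apply: is_derive1_continuous (dG _ _).
    by rewrite in_itv/= lexx ltW.
  + apply: cvg_at_left_filter; apply: is_derive1_continuous (dG _ _).
    by rewrite in_itv/= lexx ltW.
- by move=> x xab; rewrite derive1E; have [_] := dG x (subset_itv_oo_cc xab).
Qed.

(** The domain is enlarged to [-N, N] x [-1, 1] and Tonelli is applied; the factor 2 is the length
    of [-1, 1]. The split at 0 prepares for integrands depending on |x|. *)
Lemma integral_fst_le (Q : set (borel_plane R)) (f : R -> R) (N : R) : 0 < N ->
  measurable Q -> continuous f -> (forall x, 0 <= f x) ->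
  (forall z, Q z -> [/\ - N <= z.1, z.1 <= N, -1 <= z.2 & z.2 <= 1]) ->
  (\int[leb2 R]_(z in Q) (f z.1)%:E <=
   2%:E * (\int[mu]_(x in `[(- N)%R, 0%R]) (f x)%:E + \int[mu]_(x in `[0%R, N]) (f x)%:E))%E.
Proof.
move=> N0 mQ cf f0 QB.
(* The abscissa 0 is counted twice, which is harmless in an upper bound and on a null set. *)
pose g x := (f \_ `[- N, 0]) x + (f \_ `[0, N]) x.
have mf : measurable_fun setT f by exact: continuous_measurable_fun.
have mr (D : interval R) : measurable_fun setT (f \_ [set` D]).
  by apply/(measurable_restrictT _ (measurable_itv D)); exact: measurable_funTS.
have mre (D : interval R) : measurable_fun setT ((fun x => (f x)%:E) \_ [set` D]).
  apply/(measurable_restrictT _ (measurable_itv D)); apply: measurable_funTS.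
  exact/measurable_EFinP.
have g0 x : 0 <= g x.
  by rewrite /g !patchE; case: ifP => _; case: ifP => _; rewrite ?addr0 ?add0r ?addr_ge0.
have mg : measurable_fun setT g by exact: measurable_funD.
pose k : R -> R := \1_(`[-1, 1]%classic).
have mk : measurable_fun setT k by exact: measurable_indic.
pose G (z : borel_plane R) := ((g z.1)%:E * (k z.2)%:E)%E.
have mG : measurable_fun setT G.
  apply: emeasurable_funM; apply/measurable_EFinP.
    exact: (measurableT_comp mg measurable_fst).
  exact: (measurableT_comp mk measurable_snd).
have k0 y : 0 <= k y by rewrite /k indicE.
have G0 z : (0 <= G z)%E by rewrite /G mule_ge0// lee_fin.
apply: (@le_trans _ _ (\int[leb2 R]_z G z)%E).
  rewrite integral_mkcond; apply: ge0_le_integral => //.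
  - by move=> z _; rewrite patchE; case: ifP => // _; rewrite lee_fin.
  - apply/(measurable_restrictT _ mQ); apply: measurable_funTS.
    apply/measurable_EFinP; exact: (measurableT_comp mf measurable_fst).
  move=> z _; rewrite patchE; case: ifPn => [|_]; last exact: G0.
  rewrite inE => /QB[a1 a2 a3 a4].
  rewrite /G /k indicE mem_set ?mule1; last by rewrite /= in_itv/= a3.
  rewrite lee_fin /g !patchE; have [z0|z0] := leP 0 z.1.
    rewrite [X in _ <= _ + X]ifT; last by rewrite inE/= in_itv/= z0.
    by rewrite lerDr; case: ifP.
  rewrite [X in _ <= X + _]ifT; last by rewrite inE/= in_itv/= a1 ltW.
  by rewrite lerDl; case: ifP.
rewrite [leLHS](fubini_tonelli1 (m1 := mu) (m2 := mu) _ mG G0).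
have FE x : (fubini_F mu G x = 2%:E * (g x)%:E)%E.
  rewrite /fubini_F /G /= ge0_integralZl//; last 3 first.
  - exact/measurable_EFinP.
  - by move=> y _; rewrite lee_fin.
  - by rewrite lee_fin.
  rewrite muleC; congr (_ * _)%E.
  rewrite integral_indic//= setIT lebesgue_measure_itv/= lte_fin ifT; last by lra.
  by rewrite -EFinD; congr EFin; lra.
have -> : (\int[mu]_x fubini_F mu G x = \int[mu]_x (2%:E * (g x)%:E))%E.
  by apply: eq_integral => x _; exact: FE.
rewrite ge0_integralZl//; last 2 first.
- exact/measurable_EFinP.
- by move=> x _; rewrite lee_fin.
apply: lee_wpmul2l => //.
rewrite [in leRHS]integral_mkcond [X in (_ <= _ + X)%E]integral_mkcond.
rewrite -ge0_integralD//; last 4 first.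
- by move=> x _; rewrite patchE; case: ifP => // _; rewrite lee_fin.
- exact: mre.
- by move=> x _; rewrite patchE; case: ifP => // _; rewrite lee_fin.
- exact: mre.
rewrite le_eqVlt; apply/orP; left; apply/eqP; apply: eq_integral => x _.
by rewrite /g EFinD !patchE; congr (_ + _)%E; case: ifP.
Qed.

Lemma integral_weight_le (Q : set (borel_plane R)) (m N : R) : 0 < m -> 0 < N ->
  measurable Q ->
  (forall z, Q z -> [/\ - N <= z.1, z.1 <= N, -1 <= z.2 & z.2 <= 1]) ->
  (\int[leb2 R]_(z in Q) ((1 + `|z.1| / m)^-1)%:E <= (4 * m * ln (1 + N / m))%:E)%E.
Proof.
move=> m0 N0 mQ QB.
have w0 (x : R) : 0 < 1 + `|x| / m by rewrite ltr_pwDl// divr_ge0// ltW.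
apply: (le_trans (@integral_fst_le Q (fun x => (1 + `|x| / m)^-1) N N0 mQ _ _ QB)).
- move=> x; apply: cvgV; first by rewrite gt_eqF.
  apply: cvgD; first exact: cvg_cst.
  by apply: cvgM; [exact: norm_continuous|exact: cvg_cst].
- by move=> x; rewrite invr_ge0 ltW.
have -> : (\int[mu]_(x in `[(- N)%R, 0%R]) ((1 + `|x| / m)^-1)%:E =
    \int[mu]_(x in `[(- N)%R, 0%R]) ((1 + -1 * x / m)^-1)%:E)%E.
  apply: eq_integral => x; rewrite inE/= in_itv/= => /andP[_ x0].
  by rewrite ler0_norm// mulN1r.
have -> : (\int[mu]_(x in `[0%R, N]) ((1 + `|x| / m)^-1)%:E =
    \int[mu]_(x in `[0%R, N]) ((1 + 1 * x / m)^-1)%:E)%E.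
  apply: eq_integral => x; rewrite inE/= in_itv/= => /andP[x0 _].
  by rewrite ger0_norm// mul1r.
rewrite integral_log//; last 3 first.
- by rewrite sqrrN expr1n.
- by rewrite oppr_lt0.
- move=> t; rewrite in_itv/= => /andP[_ t0]; move: t t0 => t t0.
  by have := w0 (t : R); rewrite ler0_norm// mulN1r.
rewrite integral_log//; last 2 first.
- by rewrite expr1n.
- move=> t; rewrite in_itv/= => /andP[t0 _].
  by have := w0 (t : R); rewrite ger0_norm// mul1r.
rewrite !mulr0 !mul0r !addr0 ln1 !mulr0 mulrNN !mul1r -!EFinB -EFinD -EFinM lee_fin.
lra.
Qed.
End Log.

(** * Estimates for the first eigenfunction *)

Section Quad.
Context {R : realType}.
Variables (N m a b : R) (u : R * R -> R).
Hypothesis Nab : [/\ 0 < N, 0 <= a, a <= 1, 0 <= b & b <= N].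
Hypothesis m2 : 2 <= m.
Hypothesis m3 : m ^+ 3 = N.
Local Notation Q :=
  (open_quadrilateral (0, a) (0, -1 + a) (b, 0) (- N + b, 0)).
Hypothesis hu : first_eigenfunction Q u.

Let mQ := open_quadrilateral_measurable N a b.

(** Put e = m^-2. The rectangle of length m, the height deficit 2m/N = 2e and the profile loss eps =
    e all contribute order e, giving lambda <= pi^2 (1 + 18 e). The slice bound is pi^2 plus 2 pi^2
    / N times the moment, so the moment is at most 9 N e = 9 m. *)
Lemma first_eigenfunction_moment :
  (\int[leb2 R]_(z in Q) (`|z.1| * u z ^+ 2)%:E <= (9 * m)%:E)%E.
Proof.
have [N0 a0 a1 b0 bN] := Nab.
have [lambda [_ eu upos u1]] := hu.
have mm := m2; have mN := m3.
have m0 : 0 < m by lra.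
pose e := (m ^+ 2)^-1.
have em : m ^+ 2 * e = 1 by rewrite /e divff// sqrf_eq0 gt_eqF.
have e0 : 0 < e by rewrite invr_gt0 exprn_gt0.
have e4 : e <= 1 / 4.
  have : 4 <= m ^+ 2 by nra.
  by nra.
have Ne : N * e = m by rewrite -mN exprS -mulrA em mulr1.
have mN2 : 2 * m / N = 2 * e by rewrite -Ne; field; rewrite gt_eqF.
have mLN : 2 * m < N by rewrite -Ne; nra.
have [x0 hx0] := open_quadrilateral_rect Nab m0 mLN.
rewrite mN2 in hx0.
have r0 : 0 < 1 - 2 * e by lra.
have le1 : lambda <= (1 + e) * ((pi / m) ^+ 2 + (pi / (1 - 2 * e)) ^+ 2).
  by apply: (eigenvalue_le_rect mQ eu upos e0 _ m0 r0 hx0); lra.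
have pm : (pi / m) ^+ 2 = pi ^+ 2 * e by rewrite /e exprMn exprVn.
(* This is where [e <= 1 / 4] is sharp: it makes the factor [1 - 4 * e] nonnegative. *)
have r2 : ((1 - 2 * e) ^+ 2)^-1 <= 1 + 12 * e.
  rewrite -[leLHS]mul1r ler_pdivrMr ?exprn_gt0//.
  have -> : (1 + 12 * e) * (1 - 2 * e) ^+ 2 =
    1 + e * (4 * ((1 - 4 * e) * (2 - 3 * e))) by ring.
  by rewrite lerDl !mulr_ge0//; lra.
have p0 : 0 < (pi : R) ^+ 2 by rewrite exprn_gt0// pi_gt0.
(* (1 + e)(e + 1 + 12 e) = 1 + 14 e + 13 e^2, and 13 e^2 <= 4 e for e <= 1/4. *)
have le2 : lambda <= pi ^+ 2 + pi ^+ 2 * (18 * e).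
  apply: (le_trans le1); rewrite pm exprMn exprVn.
  have -> : (1 + e) * (pi ^+ 2 * e + pi ^+ 2 * ((1 - 2 * e) ^+ 2)^-1) =
    pi ^+ 2 * ((1 + e) * (e + ((1 - 2 * e) ^+ 2)^-1)) by ring.
  have -> : pi ^+ 2 + pi ^+ 2 * (18 * e) = pi ^+ 2 * (1 + 18 * e) :> R by ring.
  rewrite ler_pM2l//; move: r2; move: (_^-1) => y r2; nra.
have cw : continuous (quad_weight N).
  move=> x; apply: cvgM; first exact: cvg_cst.
  apply: cvgD; first exact: cvg_cst.
  apply: cvgM; last exact: cvg_cst.
  by apply: cvgM; [exact: cvg_cst|exact: norm_continuous].
have w0 x : 0 <= quad_weight N x.
  rewrite /quad_weight mulr_ge0 ?(ltW p0)// addr_ge0// divr_ge0 ?mulr_ge0//.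
  exact: ltW.
have wC z : Q z -> quad_weight N z.1 <= pi ^+ 2 * (1 + 2 * N / N).
  move=> /(open_quadrilateral_bounds Nab)[h1 h2 _ _].
  rewrite /quad_weight ler_pM2l// lerD2l ler_pM2r ?invr_gt0//.
  by rewrite ler_pM2l// ler_norml; apply/andP; split; lra.
have := eigenvalue_ge mQ eu u1 cw w0 (open_quadrilateral_slices Nab) wC.
have L2u : in_L2 Q u by have [_ [_ [g1 [g2 [[[]]]]]]] := eu.
have [mu' iu] := (in_L2P u mQ).1 L2u.
pose c := pi ^+ 2 * 2 / N.
have c0 : 0 < c by rewrite divr_gt0// mulr_gt0.
have mx : measurable_fun (Q : set (borel_plane R)) (fun z => `|z.1|).
  exact: measurable_norm_fst.
have -> : (\int[leb2 R]_(z in Q) (quad_weight N z.1 * u z ^+ 2)%:E =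
  (pi ^+ 2)%:E + c%:E * \int[leb2 R]_(z in Q) (`|z.1| * u z ^+ 2)%:E)%E.
  rewrite -[X in (X + _)%E]mule1 -(normLp2_eq1 mQ u1).
  rewrite -ge0_integralZl//; last 3 first.
  - by apply/measurable_EFinP; exact: measurable_funX.
  - by move=> z _; rewrite lee_fin sqr_ge0.
  - by rewrite lee_fin ltW.
  rewrite -ge0_integralZl//; last 3 first.
  - by apply/measurable_EFinP; apply: measurable_funM => //; exact: measurable_funX.
  - by move=> z _; rewrite lee_fin mulr_ge0// sqr_ge0.
  - by rewrite lee_fin ltW.
  rewrite -ge0_integralD//; last 4 first.
  - by move=> z _; rewrite -EFinM lee_fin mulr_ge0// ?sqr_ge0// ltW.
  - by apply: measurable_funeM; apply/measurable_EFinP; exact: measurable_funX.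
  - move=> z _; rewrite -EFinM lee_fin; apply: mulr_ge0; first exact: ltW.
    by rewrite mulr_ge0 ?sqr_ge0.
  - apply: measurable_funeM; apply/measurable_EFinP; apply: measurable_funM => //.
    exact: measurable_funX.
  apply: eq_integral => z _; rewrite -!EFinM -EFinD; congr EFin.
  by rewrite /quad_weight /c; ring.
move=> /le_trans /(_ (_ : lambda%:E <= (pi ^+ 2)%:E + c%:E * (9 * m)%:E)%E).
have e9 : pi ^+ 2 * (18 * e) = c * (9 * m).
  by rewrite /c -Ne; field; rewrite gt_eqF.
clearbody c.
rewrite -EFinM -EFinD -e9 lee_fin => /(_ le2).
rewrite EFinD e9 leeD2lE//.
by rewrite [(c * (9 * m))%:E]EFinM lee_pmul2l// lte_fin.
Qed.

Lemma first_eigenfunction_in_L2 : in_L2 Q u.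
Proof. by have [lambda [_ [_ [_ [g1 [g2 [[[]]]]]]]]] := hu. Qed.

(** Markov's inequality: where |x| > m^2 one has u^2 <= m^-2 |x| u^2, so the moment bound leaves
    mass at most 9/m there. The cutoff m^2 lies between the scale m of the moment and the length
    m^3, which makes both the lost mass and the area ratio of order 1/m. *)
Lemma first_eigenfunction_localised :
  1 - 9 / m <= integral2 (Q `&` [set z | `|z.1| <= m ^+ 2]) (fun z => u z ^+ 2)
    <= 1.
Proof.
have [N0 a0 a1 b0 bN] := Nab.
have [lambda [_ eu upos u1]] := hu.
have mm := m2; have m0 : 0 < m by lra.
have [mu' iu] := (in_L2P u mQ).1 first_eigenfunction_in_L2.
have int1 := normLp2_eq1 mQ u1.
set B := [set z | `|z.1| <= m ^+ 2].
have mB := measurable_norm_fst_le (m ^+ 2).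
have mA : measurable (Q `&` B : set (borel_plane R)) by exact: measurableI.
have mu2 : measurable_fun Q (fun z => (u z ^+ 2)%:E).
  by apply/measurable_EFinP; exact: measurable_funX.
have mx : measurable_fun Q (fun z => (`|z.1| * u z ^+ 2)%:E).
  apply/measurable_EFinP; apply: measurable_funM; last exact: measurable_funX.
  exact: measurable_norm_fst.
have le1 : (\int[leb2 R]_(z in Q `&` B) (u z ^+ 2)%:E <= 1)%E.
  rewrite -int1; apply: ge0_subset_integral => //.
    by move=> z _; rewrite lee_fin sqr_ge0.
have ge0 : (0 <= \int[leb2 R]_(z in Q `&` B) (u z ^+ 2)%:E)%E.
  by apply: integral_ge0 => z _; rewrite lee_fin sqr_ge0.
have c0 : 0 < (m ^+ 2)^-1 by rewrite invr_gt0 exprn_gt0.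
have ge1 : (1 <= \int[leb2 R]_(z in Q `&` B) (u z ^+ 2)%:E +
    ((m ^+ 2)^-1)%:E * \int[leb2 R]_(z in Q) (`|z.1| * u z ^+ 2)%:E)%E.
  rewrite -int1 integral_mkcondr -ge0_integralZl//; last 2 first.
  - by move=> z _; rewrite lee_fin mulr_ge0// sqr_ge0.
  - by rewrite lee_fin ltW.
  have mr : measurable_fun Q ((fun z => (u z ^+ 2)%:E) \_ B).
    by apply: (measurable_restrict _ mB mQ).1; exact: measurable_funS mu2.
  rewrite -ge0_integralD//; last 3 first.
  - by move=> z _; rewrite patchE; case: ifP => // _; rewrite lee_fin sqr_ge0.
  - move=> z _; rewrite -EFinM lee_fin; apply: mulr_ge0; first exact: ltW.
    by rewrite mulr_ge0 ?sqr_ge0.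
  - exact: measurable_funeM.
  apply: ge0_le_integral => //.
  - by move=> z _; rewrite lee_fin sqr_ge0.
  - by apply: emeasurable_funD => //; exact: measurable_funeM.
  move=> z _; rewrite patchE; case: ifPn => [_|].
    rewrite leeDl// -EFinM lee_fin; apply: mulr_ge0; first exact: ltW.
    by rewrite mulr_ge0 ?sqr_ge0.
  move=> /negP; rewrite inE /B/= => /negP; rewrite -ltNge => zm.
  rewrite add0e -EFinM lee_fin mulrA ler_peMl ?sqr_ge0//.
  by rewrite mulrC ler_pdivlMr ?exprn_gt0// mul1r ltW.
have /fineK If : (\int[leb2 R]_(z in Q `&` B) (u z ^+ 2)%:E)%E \is a fin_num.
  by rewrite ge0_fin_numE// (le_lt_trans le1)// ltry.
rewrite /integral2 /Rintegral.
move: le1 ge1; rewrite -If; set I := fine _; rewrite lee_fin => -> ge1.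
rewrite andbT.
have := first_eigenfunction_moment.
move=> /(lee_wpmul2l (_ : 0 <= ((m ^+ 2)^-1)%:E)%E); rewrite lee_fin => /(_ (ltW c0)).
move=> /(leeD2l I%:E) /(le_trans ge1).
rewrite -EFinM -EFinD lee_fin.
have -> : (m ^+ 2)^-1 * (9 * m) = 9 / m by field; rewrite gt_eqF.
by rewrite lerBlDr.
Qed.

(** The weight 1 + |x|/m is scaled by the moment bound, so its integral against u^2 is at most 1 + 9
    = 10. The square of the norm is then at most 10 times the integral [K] of the inverse weight,
    that is 10 times 4 m ln (1 + m^2). *)
Lemma first_eigenfunction_L1 :
  fine (normLp Q 1 u) ^+ 2 <= 40 * m * ln (1 + m ^+ 2).
Proof.
have [N0 a0 a1 b0 bN] := Nab.
have [lambda [_ eu upos u1]] := hu.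
have mm := m2; have m0 : 0 < m by lra.
have [mu' iu] := (in_L2P u mQ).1 first_eigenfunction_in_L2.
have int1 := normLp2_eq1 mQ u1.
pose w (z : R * R) := 1 + `|z.1| / m.
have w0 z : 0 < w z by rewrite /w ltr_pwDl// divr_ge0// ltW.
have mw : measurable_fun (Q : set (borel_plane R)) w.
  apply: measurable_funD => //; apply: measurable_funM => //.
  exact: measurable_norm_fst.
have mwu : measurable_fun (Q : set (borel_plane R)) (fun z => w z * u z ^+ 2).
  by apply: measurable_funM => //; exact: measurable_funX.
have mwi : measurable_fun (Q : set (borel_plane R)) (fun z => (w z)^-1).
  have cw : continuous (fun z : R * R => (w z)^-1).
    move=> z; apply: cvgV; first by rewrite gt_eqF.
    apply: cvgD; first exact: cvg_cst.
    apply: cvgM; last exact: cvg_cst.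
    apply: (@continuous_comp _ _ _ fst (fun x : R => `|x|)); first exact: cvg_fst.
    exact: norm_continuous.
  exact: continuous_plane_measurable.
pose K := 4 * m * ln (1 + m ^+ 2).
have K0 : 0 < K by rewrite /K !mulr_gt0// ln_gt0// ltrDl exprn_gt0.
have wi : (\int[leb2 R]_(z in Q) ((w z)^-1)%:E <= K%:E)%E.
  have -> : K = 4 * m * ln (1 + N / m).
    have -> : N / m = m ^+ 2 by rewrite -m3; field; rewrite gt_eqF.
    by [].
  apply: integral_weight_le => //.
  move=> z /(open_quadrilateral_bounds Nab)[h1 h2 h3 h4]; split; lra.
have wu : (\int[leb2 R]_(z in Q) (w z * u z ^+ 2)%:E <= 10%:E)%E.
  have -> : (\int[leb2 R]_(z in Q) (w z * u z ^+ 2)%:E =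
      1 + (m^-1)%:E * \int[leb2 R]_(z in Q) (`|z.1| * u z ^+ 2)%:E)%E.
    have mx : measurable_fun Q (fun z => (`|z.1| * u z ^+ 2)%:E).
      apply/measurable_EFinP; apply: measurable_funM; last exact: measurable_funX.
      exact: measurable_norm_fst.
    rewrite -int1 -ge0_integralZl//; last 2 first.
    - by move=> z _; rewrite lee_fin mulr_ge0// sqr_ge0.
    - by rewrite lee_fin invr_ge0 ltW.
    rewrite -ge0_integralD//; last 4 first.
    - by move=> z _; rewrite lee_fin sqr_ge0.
    - by apply/measurable_EFinP; exact: measurable_funX.
    - move=> z _; rewrite -EFinM lee_fin; apply: mulr_ge0.
        by rewrite invr_ge0 ltW.
      by rewrite mulr_ge0 ?sqr_ge0.
    - exact: measurable_funeM.
    apply: eq_integral => z _; rewrite -EFinM -EFinD; congr EFin.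
    by rewrite /w; ring.
  have := first_eigenfunction_moment.
  have mi : (0 <= (m^-1)%:E)%E by rewrite lee_fin invr_ge0 ltW.
  move=> /(lee_wpmul2l mi) /(leeD2l 1%:E) /le_trans; apply.
  rewrite -EFinM -EFinD lee_fin mulrCA mulVf ?gt_eqF//; lra.
have N1 : (normLp Q 1 u = \int[leb2 R]_(z in Q) `|u z|%:E)%E.
  rewrite /normLp Lnorm1 [RHS]integral_mkcond; apply: eq_integral => z _ /=.
  by rewrite !patchE; case: ifP => //= _; rewrite normr0.
(* AM-GM: 2 |u| <= t w u^2 + 1 / (t w), with the optimal t *)
pose t := Num.sqrt (K / 10).
have t0 : 0 < t by rewrite sqrtr_gt0 divr_gt0.
have t2 : t ^+ 2 = K / 10 by rewrite sqr_sqrtr// divr_ge0// ltW.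
have ti : 0 < (2 * t)^-1 by rewrite invr_gt0 mulr_gt0.
have th : 0 < t / 2 by rewrite divr_gt0.
have le1 : (normLp Q 1 u <= (10 * t)%:E)%E.
  apply: (@le_trans _ _ ((t / 2)%:E * \int[leb2 R]_(z in Q) (w z * u z ^+ 2)%:E +
     ((2 * t)^-1)%:E * \int[leb2 R]_(z in Q) ((w z)^-1)%:E)%E).
    rewrite N1 -!ge0_integralZl//; last 6 first.
    - exact/measurable_EFinP.
    - by move=> z _; rewrite lee_fin invr_ge0 ltW.
    - by rewrite lee_fin ltW.
    - exact/measurable_EFinP.
    - by move=> z _; rewrite lee_fin mulr_ge0 ?sqr_ge0// ltW.
    - by rewrite lee_fin ltW.
    rewrite -ge0_integralD//; last 4 first.
    - move=> z _; rewrite -EFinM lee_fin; apply: mulr_ge0; first exact: ltW.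
      by rewrite mulr_ge0 ?sqr_ge0// ltW.
    - by apply: measurable_funeM; exact/measurable_EFinP.
    - move=> z _; rewrite -EFinM lee_fin; apply: mulr_ge0; first exact: ltW.
      by rewrite invr_ge0 ltW.
    - by apply: measurable_funeM; exact/measurable_EFinP.
    apply: ge0_le_integral => //.
    - by apply/measurable_EFinP; exact: measurableT_comp.
    - by apply: emeasurable_funD; apply: measurable_funeM; exact/measurable_EFinP.
    move=> z _; rewrite -!EFinM -EFinD lee_fin -subr_ge0.
    have -> : t / 2 * (w z * u z ^+ 2) + (2 * t)^-1 * (w z)^-1 - `|u z| =
      (t * w z * `|u z| - 1) ^+ 2 / (2 * t * w z).
      by rewrite -[u z ^+ 2]real_normK ?num_real//; field; rewrite !gt_eqF.
    by rewrite divr_ge0 ?sqr_ge0// !mulr_ge0// ltW.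
  have -> : 10 * t = t / 2 * 10 + (2 * t)^-1 * K.
    have -> : K = 10 * t ^+ 2 by rewrite t2; field.
    by field; rewrite gt_eqF.
  rewrite EFinD; apply: leeD; rewrite [leRHS]EFinM; apply: lee_wpmul2l => //;
    by rewrite lee_fin ltW.
have n0 : (0 <= normLp Q 1 u)%E by exact: Lnorm_ge0.
have nf : normLp Q 1 u \is a fin_num by rewrite ge0_fin_numE// (le_lt_trans le1)// ltry.
have le2 : fine (normLp Q 1 u) <= 10 * t by rewrite -lee_fin fineK.
have f0 : 0 <= fine (normLp Q 1 u) by exact: fine_ge0.
have : fine (normLp Q 1 u) ^+ 2 <= (10 * t) ^+ 2.
  by rewrite lerXn2r ?nnegrE// mulr_ge0// ltW.
move=> /le_trans; apply; rewrite exprMn t2 /K; lra.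
Qed.
End Quad.

(** * Cube roots and the rate of decay *)

Section Asymptotics.
Context {R : realType}.

Definition cbrt (x : R) : R := x `^ (1 / 3).

Lemma cbrt_gt0 x : 0 < x -> 0 < cbrt x.
Proof. exact: powR_gt0. Qed.

Lemma cbrtX3 x : 0 <= x -> cbrt x ^+ 3 = x.
Proof.
move=> x0; rewrite /cbrt -powR_mulrn ?powR_ge0// -powRrM.
by rewrite div1r mulVf ?pnatr_eq0// powRr1.
Qed.

Lemma cbrt_ge y x : 0 <= y -> y ^+ 3 <= x -> y <= cbrt x.
Proof.
move=> y0 yx; have x0 : 0 <= x by apply: le_trans yx; rewrite exprn_ge0.
by rewrite -(@ler_pXn2r _ 3)// ?nnegrE ?powR_ge0// cbrtX3.
Qed.

Lemma cbrt_nat_inv_cvg0 : (fun n : nat => (cbrt n%:R)^-1) @ \oo --> (0 : R).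
Proof.
apply/cvgrPdist_le => /= e e0; near=> n.
have n0 : 0 < n%:R :> R by rewrite ltr0n; near: n; exists 1%N.
have m0 := cbrt_gt0 n0.
rewrite sub0r normrN ger0_norm ?invr_ge0 ?(ltW m0)//.
rewrite -[e]invrK lef_pV2 ?posrE ?invr_gt0//.
apply: cbrt_ge; first by rewrite invr_ge0 ltW.
by near: n; exact: nbhs_infty_ger.
Unshelve. all: by end_near. Qed.

(** Puts the announced rate in the form m / n in which the estimates for the L^1 norm and the area
    produce it. *)
Lemma powR_neg_two_thirds x : 0 < x -> x `^ (- (2 / 3)) = cbrt x / x.
Proof.
move=> x0; have -> : - (2 / 3) = 1 / 3 - 1 :> R by field.
by rewrite powRB ?powRr1 ?(ltW x0)//; apply/implyP => _; rewrite gt_eqF.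
Qed.
End Asymptotics.

Unset Implicit Arguments.

Theorem mainTheorem5 (R : realType) (a b : nat -> R)
    (ha : forall n, (0 < n)%N -> 0 <= a n <= 1)
    (hb : forall n, (0 < n)%N -> 0 <= b n <= n%:R)
    (Omega : nat -> set (R * R))
    (hOmega : forall n, (0 < n)%N ->
       Omega n = open_quadrilateral (0, a n) (0, -1 + a n)
                                    (b n, 0) (- n%:R + b n, 0))
    (u : nat -> R * R -> R)
    (hu : forall n, (0 < n)%N -> first_eigenfunction (Omega n) (u n)) :
  (fun n : nat => (area (Omega n))^-1 * fine (normLp (Omega n) 1 (u n)) ^+ 2)
    =O_\oo (fun n : nat => n%:R `^ (- (2 / 3)) * ln n%:R) /\
  localising Omega u.
Proof.
have Nab n : (0 < n)%N ->
    [/\ 0 < n%:R :> R, 0 <= a n, a n <= 1, 0 <= b n & b n <= n%:R].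
  by move=> n0; have /andP[? ?] := ha n n0; have /andP[? ?] := hb n n0;
    rewrite ltr0n.
have hu' n : (0 < n)%N -> first_eigenfunction (open_quadrilateral (0, a n)
    (0, -1 + a n) (b n, 0) (- n%:R + b n, 0)) (u n).
  by move=> n0; rewrite -hOmega//; exact: hu.
pose m (n : nat) : R := cbrt n%:R.
have m0 n : (0 < n)%N -> 0 < m n by move=> n0; rewrite cbrt_gt0// ltr0n.
have m3 n : m n ^+ 3 = n%:R by rewrite cbrtX3.
have m2 n : (8 <= n)%N -> 2 <= m n.
  by move=> n8; apply: cbrt_ge => //; rewrite -natrX ler_nat.
have area_ge n : (0 < n)%N -> n%:R / 32 <= area (Omega n).
  move=> n0; have [h1 h2] := open_quadrilateral_area (Nab n n0).
  rewrite hOmega// /area -lee_fin fineK//.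
  by rewrite ge0_fin_numE ?measure_ge0// (le_lt_trans h2)// ltry.
have area_gt0 n : (0 < n)%N -> 0 < area (Omega n).
  by move=> n0; apply: lt_le_trans (area_ge n n0); rewrite divr_gt0// ltr0n.
split.
  (* 40 comes from the bound on the L^1 norm and 32 from the lower bound n/32 on the area. *)
  apply/eqO_exP; exists (40 * 32); first by rewrite mulr_gt0// ltr0n.
  near=> n.
  have n8 : (8 <= n)%N by near: n; exists 8%N.
  have n0 : (0 < n)%N by exact: leq_trans n8.
  have nR : 0 < n%:R :> R by rewrite ltr0n.
  have mn2 := m2 n n8; have mn0 := m0 n n0.
  have L1 := first_eigenfunction_L1 (Nab n n0) mn2 (m3 n) (hu' n n0).
  rewrite -hOmega// in L1.
  have ln0 : 0 <= ln n%:R :> R by rewrite ln_ge0// ler1n.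
  rewrite ger0_norm; last by rewrite mulr_ge0 ?sqr_ge0// invr_ge0 ltW// area_gt0.
  rewrite powR_neg_two_thirds// -/(m n) ger0_norm; last first.
    by rewrite mulr_ge0// divr_ge0// ltW.
  (* For m >= 2 one has 1 + m^2 <= m^3 = n. *)
  have lnm : ln (1 + m n ^+ 2) <= ln n%:R.
    rewrite ler_ln ?posrE ?addr_gt0 ?exprn_gt0// -(m3 n).
    move: mn2; move: (m n) => x x2; nra.
  apply: (@le_trans _ _ ((n%:R / 32)^-1 * (40 * m n * ln n%:R))).
    apply: ler_pM.
    - by rewrite invr_ge0 ltW// area_gt0.
    - exact: sqr_ge0.
    - by rewrite lef_pV2 ?posrE ?area_gt0 ?area_ge// divr_gt0.
    - by apply: (le_trans L1); rewrite ler_wpM2l// mulr_ge0// ltW.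
  rewrite le_eqVlt; apply/orP; left; apply/eqP; field; rewrite gt_eqF//.
split.
  move=> n n0; split; last by have [lambda []] := hu n n0.
  by rewrite hOmega//; exact: first_eigenfunction_in_L2 (hu' n n0).
pose A n : set (R * R) := Omega n `&` [set z | `|z.1| <= m n ^+ 2].
have mA n : (0 < n)%N -> measurable (A n : set (borel_plane R)).
  move=> n0; apply: measurableI; last exact: measurable_norm_fst_le.
  by rewrite hOmega//; exact: open_quadrilateral_measurable.
exists A; split.
- by move=> n n0; split; [exact: mA|exact: subIsetl].
(* 128 = 4 * 32: the set lies in a box of area 4 m^2, and the quadrilateral has area at least m^3 /
   32. *)
- have c : (fun n => 128 * (m n)^-1) @ \oo --> (0 : R).
    rewrite -[X in _ --> X](mulr0 128).
    by apply: cvgM; [exact: cvg_cst|exact: cbrt_nat_inv_cvg0].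
  apply: (squeeze_cvgr _ (cvg_cst 0) c); near=> n.
  have n0 : (0 < n)%N by near: n; exists 1%N.
  have mn0 := m0 n n0; have nR : 0 < n%:R :> R by rewrite ltr0n.
  rewrite divr_ge0 ?fine_ge0 ?measure_ge0//=.
  pose B : set (R * R) := `[- m n ^+ 2, m n ^+ 2] `*` `[-1, 1].
  have mB : measurable (B : set (borel_plane R)).
    by apply: measurableX; exact: measurable_itv.
  have mAn := mA n n0.
  have AB : A n `<=` B.
    have [_ a0 a1 _ _] := Nab n n0.
    move=> z [/=]; rewrite hOmega// => /(open_quadrilateral_bounds (Nab n n0))[_ _ h1 h2].
    by rewrite ler_norml => zm; split; rewrite /= in_itv//=; apply/andP; split; lra.
  have le1 : (leb2 R (A n) <=
      (4 * m n ^+ 2)%:E)%E.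
    apply: (@le_trans _ _ (leb2 R B)); first by apply: le_measure; rewrite ?inE.
    rewrite leb2_rect; [by rewrite lee_fin; lra| |by lra].
    by have := sqr_ge0 (m n); lra.
  have le2 : area (A n) <= 4 * m n ^+ 2.
    rewrite /area -lee_fin fineK// ge0_fin_numE ?measure_ge0//.
    by rewrite (le_lt_trans le1)// ltry.
  rewrite ler_pdivrMr ?area_gt0//; apply: (le_trans le2).
  apply: (@le_trans _ _ (128 * (m n)^-1 * (n%:R / 32))).
    rewrite -(m3 n) le_eqVlt; apply/orP; left; apply/eqP; field.
    by rewrite gt_eqF.
  by rewrite ler_wpM2l ?area_ge// mulr_ge0// invr_ge0 ltW.
- have c : (fun n => 1 - 9 * (m n)^-1) @ \oo --> (1 : R).
    rewrite -[X in _ --> X](subr0 1) -[X in _ - X](mulr0 9).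
    apply: cvgB; first exact: cvg_cst.
    by apply: cvgM; [exact: cvg_cst|exact: cbrt_nat_inv_cvg0].
  apply: (@squeeze_cvgr _ _ _ _ _ _ _ _ 1 c (cvg_cst (1 : R))); near=> n.
  have n8 : (8 <= n)%N by near: n; exists 8%N.
  have n0 : (0 < n)%N by exact: leq_trans n8.
  rewrite /A hOmega//.
  exact: first_eigenfunction_localised (Nab n n0) (m2 n n8) (m3 n) (hu' n n0).
Unshelve. all: by end_near. Qed.
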